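(* Let $n\ge2$, $1\le m<n$, let $(\Sigma_t)_{t\in[0,1]}$ be a continuously differentiable curve in $\mathrm{Sym}^+(n)$, and let $Y_0,Y_1\in\mathbb{R}^{n\times m}$. If there exists at least one admissible pair for Problem 1, then Problem 1 has an absolute (global) minimizer $(K^\star_t,\Phi^\star_t)_{t\in[0,1]}$ among all admissible pairs.
   Context: $\mathrm{Sym}^+(n)$ denotes the set of real symmetric positive-definite $n\times n$ matrices and $\mathrm{GL}(n)$ the group of real invertible $n\times n$ matrices. Given $\Sigma_0\in\mathrm{Sym}^+(n)$, for a pair of curves $(K_t,\Phi_t)_{t\in[0,1]}$ the kinetic energy cost is $J_{\rm KE}=\frac12\int_0^1\mathrm{tr}(K_t\Phi_t\Sigma_0\Phi_t^\top K_t^\top)\,dt$. Problem 1: given a continuously differentiable curve $(\Sigma_t)_{t\in[0,1]}$ in $\mathrm{Sym}^+(n)$ and $Y_0,Y_1\in\mathbb{R}^{n\times m}$ ($m<n$), minimize $J_{\rm KE}$ over pairs $(K_t,\Phi_t)_{t\in[0,1]}$ subject to: $\dot\Phi_t=K_t\Phi_t$, $\Phi_0=I$; $\Sigma_t=\Phi_t\Sigma_0\Phi_t^\top$ for all $t\in[0,1]$; and $Y_1=\Phi_1Y_0$. A pair $(K_t,\Phi_t)_{t\in[0,1]}$ is admissible for Problem 1 if $(K_t)$ is square integrable, $(\Phi_t)$ is absolutely continuous with values in $\mathrm{GL}(n)$, $\Phi_0=I$ and $\dot\Phi_t=K_t\Phi_t$ wherever $\dot\Phi_t$ exists, $\Sigma_t=\Phi_t\Sigma_0\Phi_t^\top$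 for all $t\in[0,1]$, $Y_1=\Phi_1Y_0$, and $J_{\rm KE}<\infty$. *)

(* Defs.v *)
From HB Require Import structures.
From mathcomp Require Import all_boot all_order all_algebra.
From mathcomp Require Import all_classical all_reals all_analysis.
Set Implicit Arguments. Unset Strict Implicit. Unset Printing Implicit Defensive.
Import Order.TTheory GRing.Theory Num.Theory.
Import numFieldNormedType.Exports.
Local Open Scope classical_set_scope.
Local Open Scope ring_scope.

Section Defs.
Variable R : realType.

Definition symPD (n : nat) (A : 'M[R]_n) : Prop :=
  A^T = A /\ forall x : 'cV[R]_n, x != 0 -> 0 < (x^T *m A *m x) 0 0.

Definition has_deriv01 (f df : R -> R) : Prop :=
  forall t, 0 <= t <= 1 ->
    (t < 1 -> (fun h => h^-1 * (f (t + h) - f t)) @ 0^'+ --> df t) /\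
    (0 < t -> (fun h => h^-1 * (f (t + h) - f t)) @ 0^'- --> df t).

Definition C1_curve01 (n : nat) (S : R -> 'M[R]_n) : Prop :=
  exists dS : R -> 'M[R]_n, forall i j,
    has_deriv01 (fun t => S t i j) (fun t => dS t i j) /\
    {within `[0, 1], continuous (fun t => dS t i j)}.

Definition abs_cont01 (f : R -> R) : Prop :=
  forall e : R, 0 < e -> exists2 d : R, 0 < d &
    forall (N : nat) (a b : 'I_N -> R),
      (forall k, 0 <= a k /\ a k <= b k /\ b k <= 1) ->
      (forall k l, k != l -> b k <= a l \/ b l <= a k) ->
      \sum_(k < N) (b k - a k) < d ->
      \sum_(k < N) `|f (b k) - f (a k)| < e.

Definition sq_integrable01 (f : R -> R) : Prop :=
  measurable_fun (`[0, 1] : set R) f /\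
  (\int[@lebesgue_measure R]_(t in `[0%R, 1%R]) ((f t) ^+ 2)%:E < +oo)%E.

Definition J_KE (n : nat) (Sigma0 : 'M[R]_n) (K Phi : R -> 'M[R]_n) : \bar R :=
  ((2^-1)%:E * \int[@lebesgue_measure R]_(t in `[0%R, 1%R])
     (\tr (K t *m Phi t *m Sigma0 *m (Phi t)^T *m (K t)^T))%:E)%E.

Definition admissible (n m : nat) (Sigma : R -> 'M[R]_n) (Y0 Y1 : 'M[R]_(n, m))
  (K Phi : R -> 'M[R]_n) : Prop :=
  (forall i j, sq_integrable01 (fun t => K t i j)) /\
      (forall i j, abs_cont01 (fun t => Phi t i j)) /\
      (forall t, 0 <= t <= 1 -> Phi t \in unitmx) /\
      Phi 0 = 1%:M /\
      (forall t, 0 < t < 1 ->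
         (forall i j, derivable (fun s => Phi s i j) t 1) ->
         forall i j, derive1 (fun s => Phi s i j) t = (K t *m Phi t) i j) /\
      (forall t, 0 <= t <= 1 -> Sigma t = Phi t *m Sigma 0 *m (Phi t)^T) /\
      Y1 = Phi 1 *m Y0 /\
      (J_KE (Sigma 0%R) K Phi < +oo)%E.

End Defs.

(* Main.v *)
(** Direct method, with Riesz's finite-difference energy in place of weak
    compactness.  Write [q M = tr (M Sigma_0 M^T)].  An absolutely continuous
    [Phi] is almost everywhere differentiable and the integral of its derivative
    (its variation is absolutely continuous, so the associated
    Lebesgue-Stieltjes measure has a density); Jensen's inequality then bounds
    the sums of [q (Phi b - Phi a) / (b - a)] over disjoint intervals of [[0,1]]
    by [2 J_KE].  The constraint [Phi_t Sigma_0 Phi_t^T = Sigma_t] makes the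
    admissible curves pointwise bounded, so a minimizing sequence converges
    pointwise along an ultrafilter, and both the constraints and the bound on
    the finite-difference sums survive in the limit.  Conversely such a bound
    forces absolute continuity, and Fatou's lemma, applied to the difference
    quotients on the grids [i/N], recovers a velocity [K] of energy at most the
    bound. *)

Require Import Defs.
From HB Require Import structures.
From mathcomp Require Import all_boot all_order all_algebra.
From mathcomp Require Import all_classical all_reals all_analysis.
From mathcomp Require Import measurable_realfun.
From mathcomp Require Import ring lra.
Set Implicit Arguments. Unset Strict Implicit. Unset Printing Implicit Defensive.
Import Order.TTheory GRing.Theory Num.Theory.
Import numFieldNormedType.Exports.
Local Open Scope classical_set_scope.
Local Open Scope ring_scope.


(** * Absolutely continuous functions *)

Section DisjointFamilies.
Variable R : realType.
Implicit Types f : R -> R.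

(** The index set is any finite type rather than ['I_N], so that subdividing the intervals of a
    family gives a family indexed by dependent pairs. The intervals may be listed in any order and
    may be single points. *)
Definition disjoint_family (I : finType) (a b : I -> R) : Prop :=
  (forall k, 0 <= a k /\ a k <= b k /\ b k <= 1) /\
  (forall k l, k != l -> b k <= a l \/ b l <= a k).

Lemma abs_cont01_family f e : abs_cont01 f -> 0 < e ->
  exists2 d : R, 0 < d & forall (I : finType) (a b : I -> R),
    disjoint_family a b -> \sum_k (b k - a k) < d ->
    \sum_k `|f (b k) - f (a k)| < e.
Proof.
move=> fac e0; have [d d0 dP] := fac _ e0; exists d => // I a b [ab dab].
rewrite (reindex (@enum_val I predT)); last exact: onW_bij (@enum_val_bij I).
rewrite [X in _ -> X < _](reindex (@enum_val I predT)); last first.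
  exact: onW_bij (@enum_val_bij I).
move=> sd; apply: (dP #|I| (a \o enum_val) (b \o enum_val)) => //=.
by move=> k l kl; apply: dab; rewrite (inj_eq enum_val_inj).
Qed.

Lemma itv_partition_le_nth (a b : R) s i j : itv_partition a b s ->
  (i <= j)%N -> (j <= size s)%N -> nth b (a :: s) i <= nth b (a :: s) j.
Proof.
move=> [p _] ij js.
have := @sorted_leq_nth _ <=%O (@le_trans _ R) (@lexx _ R) b (a :: s).
apply => //; rewrite ?inE ?ltnS //; last exact: leq_trans ij js.
by rewrite /=; apply: sub_path p => x y /ltW.
Qed.

(** Cutting each interval along its partition gives a finer disjoint family of the same total
    length, so the [d] of absolute continuity serves unchanged. *)
Lemma abs_cont01_variations f e : abs_cont01 f -> 0 < e ->
  exists2 d : R, 0 < d & forall (I : finType) (a b : I -> R) (s : I -> seq R),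
    disjoint_family a b -> \sum_k (b k - a k) < d ->
    (forall k, itv_partition (a k) (b k) (s k)) ->
    \sum_k variation (a k) (b k) f (s k) < e.
Proof.
move=> fac e0; have [d d0 dP] := abs_cont01_family fac e0.
exists d => // I a b s [ab dab] sd sP.
pose J := {k : I & 'I_(size (s k))}.
pose A (p : J) := nth (b (tag p)) (a (tag p) :: s (tag p)) (tagged p).
pose B (p : J) := nth (b (tag p)) (a (tag p) :: s (tag p)) (tagged p).+1.
have Ale p : a (tag p) <= A p.
  by apply: itv_partition_nth_ge (sP _); rewrite ltnS ltnW.
have Ble p : B p <= b (tag p).
  by apply: itv_partition_nth_le (sP _); rewrite ltnS.
have AB p : A p <= B p by apply: itv_partition_le_nth (sP _) _ _.
have -> : \sum_k variation (a k) (b k) f (s k) = \sum_(p : J) `|f (B p) - f (A p)|.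
  rewrite -(@sig_big_dep _ _ _ _ (fun k => 'I_(size (s k))) xpredT
    (fun _ _ => true) (fun k i => `|f (nth (b k) (a k :: s k) i.+1) -
      f (nth (b k) (a k :: s k) i)|)).
  by apply: eq_bigr => k _; rewrite /variation big_mkord.
apply: (dP _ A B).
  split=> [p|[k i] [l j] pl].
    split; first by apply: le_trans (Ale p); have [] := ab (tag p).
    split=> //; apply: (le_trans (Ble p)); by have [_ []] := ab (tag p).
  have [kl|kl] := eqVneq k l; last first.
    have [H|H] := dab _ _ kl; [left|right].
      exact: le_trans (Ble (Tagged (fun k => 'I_(size (s k))) i)) (le_trans H (Ale (Tagged (fun k => 'I_(size (s k))) j))).
    exact: le_trans (Ble (Tagged (fun k => 'I_(size (s k))) j)) (le_trans H (Ale (Tagged (fun k => 'I_(size (s k))) i))).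
  (* For two pieces of the same interval, their positions in the partition decide which comes
     first. *)
  subst l; rewrite /A /B /=.
  have [ij|ji|/ord_inj ij] := ltngtP i j.
  - by left; exact: (itv_partition_le_nth (i := i.+1) (sP k) ij (ltnW (ltn_ord j))).
  - by right; exact: (itv_partition_le_nth (i := j.+1) (sP k) ji (ltnW (ltn_ord i))).
  - by move: pl; rewrite ij eqxx.
(* The lengths of the pieces of one interval telescope to its length. *)
have <- : \sum_k (b k - a k) = \sum_(p : J) (B p - A p) => //.
rewrite -(@sig_big_dep _ _ _ _ (fun k => 'I_(size (s k))) xpredT
    (fun _ _ => true) (fun k i => (nth (b k) (a k :: s k) i.+1) -
      (nth (b k) (a k :: s k) i))).
apply: eq_bigr => k _.
rewrite -(big_mkord xpredT (fun i => nth (b k) (a k :: s k) i.+1 - nth (b k) (a k :: s k) i)).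
rewrite telescope_sumr //= -[LHS]/(_ - nth (b k) (a k :: s k) 0); congr (_ - _).
by rewrite (itv_partition_nth_size _ (sP k)).
Qed.

Lemma itv_partition_exists (a b : R) : a <= b -> exists s, itv_partition a b s.
Proof.
rewrite le_eqVlt => /predU1P[->|ab]; first by exists [::]; split => /=.
by exists [:: b]; exact: itv_partition1.
Qed.

(** The supremum over partitions is taken in each interval separately. Near-optimal partitions
    require finite total variation, so a crude bound on each interval comes first. *)
Lemma abs_cont01_total_variation f e : abs_cont01 f -> 0 < e ->
  exists2 d : R, 0 < d & forall (I : finType) (a b : I -> R),
    disjoint_family a b -> \sum_k (b k - a k) < d ->
    (\sum_k total_variation (a k) (b k) f <= e%:E)%E.
Proof.
move=> fac e0; have [d d0 dP] := abs_cont01_variations fac e0.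
exists d => // I a b dab sd; have [ab _] := dab.
have [s0 s0P] : {s0 : I -> seq R & forall k, itv_partition (a k) (b k) (s0 k)}.
  by apply: (@choice _ _ (fun k s => itv_partition (a k) (b k) s)) => k;
     apply: itv_partition_exists; have [_ []] := ab k.
(* A partition of the interval [k] alone is completed by arbitrary partitions [s0] of the others,
   whose variations are nonnegative. *)
have TVe k : (total_variation (a k) (b k) f <= e%:E)%E.
  apply: ge_ereal_sup => _ [_ [s sP <-] <-]; rewrite lee_fin ltW //.
  pose s1 l := if l == k then s else s0 l.
  have s1k : s1 k = s by rewrite /s1 eqxx.
  apply: (le_lt_trans _ (dP I a b s1 dab sd _)) => [|l].
    rewrite (bigD1 k) //= s1k lerDl; apply: sumr_ge0 => l _.
    exact: variation_ge0.
  by rewrite /s1; case: eqP => [->|_].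
have TVf k : total_variation (a k) (b k) f \is a fin_num.
  rewrite ge0_fin_numE; first exact: le_lt_trans (TVe k) (ltry _).
  by apply: total_variation_ge0; have [_ []] := ab k.
apply/lee_addgt0Pr => h h0.
(* The error [h] is shared out among the intervals; the successor in the denominator covers an empty
   family. *)
pose h' := h / (#|I|.+1)%:R.
have h'0 : 0 < h' by rewrite divr_gt0.
have [s sP] : {s : I -> seq R & forall k, itv_partition (a k) (b k) (s k) /\
    (total_variation (a k) (b k) f <= (variation (a k) (b k) f (s k) + h')%:E)%E}.
  apply: (@choice _ _ (fun k s => itv_partition (a k) (b k) s /\
    (total_variation (a k) (b k) f <= (variation (a k) (b k) f s + h')%:E)%E)) => k.
  have [_ [_ [s sP <-] <-] lt] := ub_ereal_sup_adherent h'0 (TVf k).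
  exists s; split => //; rewrite EFinD -leeBlDr //; exact: ltW.
apply: (@le_trans _ _ (\sum_k (variation (a k) (b k) f (s k) + h')%:E)%E).
  by apply: lee_sum => k _; have [] := sP k.
rewrite sumEFin -EFinD lee_fin big_split /= sumr_const lerD //.
  by apply/ltW/dP => // k; have [] := sP k.
rewrite -(mulr_natr h') /h' -mulrA ger_pMr // mulrC ler_pdivrMr // mul1r ler_nat.
exact: leqnSn.
Qed.

(** On a uniform subdivision with mesh below [d] each cell has total variation at most 1, and total
    variation is additive over adjacent cells. *)
Lemma abs_cont01_TV_lty f : abs_cont01 f -> (total_variation 0 1 f < +oo)%E.
Proof.
move=> fac; have [d d0 dP] := abs_cont01_total_variation fac ltr01.
have [M Md] : exists M : nat, M.+1%:R^-1 < d.
  by have [M] := ltr_add_invr d0; rewrite add0r => ?; exists M.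
have step k : (k <= M.+1)%N -> (total_variation 0 (k%:R / M.+1%:R) f < +oo)%E.
  elim: k => [_|k ih kM]; first by rewrite mul0r total_variationxx ltry.
  have ik : k%:R / M.+1%:R <= k.+1%:R / M.+1%:R :> R.
    by rewrite ler_pM2r ?invr_gt0 // ler_nat.
  have k0 : 0 <= k%:R / M.+1%:R :> R by rewrite divr_ge0.
  have k1 : k.+1%:R / M.+1%:R <= 1 :> R by rewrite ler_pdivrMr // mul1r ler_nat.
  rewrite (total_variationD _ k0 ik) lte_add_pinfty ?ih ?(ltnW kM) //.
  have := dP 'I_1 (fun=> k%:R / M.+1%:R) (fun=> k.+1%:R / M.+1%:R).
  rewrite !big_ord1 => H; apply: (le_lt_trans (H _ _)); last exact: ltry.
    by split=> // i j; rewrite !ord1.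
  by rewrite -mulrBl -natrB // subSnn mul1r.
by have := step M.+1 (leqnn _); rewrite divff.
Qed.

End DisjointFamilies.

(** * The variation function of an absolutely continuous function *)

Section AbsContVariation.
Variable R : realType.
Implicit Types f g : R -> R.

Lemma abs_cont01_ltr f e : abs_cont01 f -> 0 < e -> exists2 d : R, 0 < d &
  forall x y, 0 <= x <= 1 -> 0 <= y <= 1 -> `|x - y| < d -> `|f x - f y| < e.
Proof.
move=> fac e0; have [d d0 dP] := abs_cont01_family fac e0; exists d => //.
have H x y : 0 <= x -> x <= y -> y <= 1 -> `|x - y| < d -> `|f x - f y| < e.
  move=> x0 xy y1; rewrite distrC ger0_norm ?subr_ge0 // => yxd.
  have := dP 'I_1 (fun=> x) (fun=> y); rewrite !big_ord1 distrC; apply => //.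
  by split=> // i j; rewrite !ord1.
move=> x y /andP[x0 x1] /andP[y0 y1] xyd.
have [xy|/ltW yx] := leP x y; first exact: H.
by rewrite distrC; apply: H => //; rewrite distrC.
Qed.

Lemma abs_cont01B f g : abs_cont01 f -> abs_cont01 g ->
  abs_cont01 (fun x => f x - g x).
Proof.
move=> fac gac e e0; have e20 : 0 < e / 2 by rewrite divr_gt0.
have [d d0 dP] := fac _ e20; have [d' d'0 d'P] := gac _ e20.
exists (Num.min d d'); first by rewrite lt_min d0 d'0.
move=> N a b ab dab; rewrite lt_min => /andP[sd sd'].
have H1 := dP N a b ab dab sd; have H2 := d'P N a b ab dab sd'.
rewrite [e in _ < e]splitr; apply: (le_lt_trans _ (ltrD H1 H2)).
rewrite -big_split /= ler_sum // => k _.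
rewrite (_ : _ - _ - _ = (f (b k) - f (a k)) - (g (b k) - g (a k))).
  exact: ler_normB.
ring.
Qed.

Definition variation_from0 f x := fine (total_variation 0 x f).

Lemma variation_from0D f x y : abs_cont01 f -> 0 <= x -> x <= y -> y <= 1 ->
  (total_variation x y f = (variation_from0 f y - variation_from0 f x)%:E)%E.
Proof.
move=> fac x0 xy y1; rewrite /variation_from0.
have y0 := le_trans x0 xy.
have := abs_cont01_TV_lty fac.
rewrite (total_variationD _ y0 y1) (total_variationD _ x0 xy).
have := total_variation_ge0 f x0; have := total_variation_ge0 f xy.
have := total_variation_ge0 f y1.
case: (total_variation 0 x f) => [u| |] //; case: (total_variation x y f) => [v| |] //;
  case: (total_variation y 1 f) => [w| |] //= _ _ _ _.
by rewrite addrAC subrr add0r.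
Qed.

Lemma variation_from0_incr f x y : abs_cont01 f -> 0 <= x -> x <= y -> y <= 1 ->
  `|f y - f x| <= variation_from0 f y - variation_from0 f x.
Proof.
by move=> fac x0 xy y1; rewrite -lee_fin -variation_from0D // total_variation_ge.
Qed.

(** The increments of [variation_from0 f] are total variations, so the uniform estimate over
    disjoint families applies; halving [e] makes the inequality strict. *)
Lemma abs_cont01_variation f : abs_cont01 f -> abs_cont01 (variation_from0 f).
Proof.
move=> fac e e0; have e20 : 0 < e / 2 by rewrite divr_gt0.
have [d d0 dP] := abs_cont01_total_variation fac e20; exists d => // N a b ab dab sd.
have := dP 'I_N a b (conj ab dab) sd.
under eq_bigr => k _.
  have [a0 [abk b1]] := ab k; rewrite variation_from0D //; over.
rewrite sumEFin lee_fin => H.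
rewrite (@le_lt_trans _ _ (e / 2)) // ?ltr_pdivrMr ?ltr_pMr ?ltr1n //.
apply: le_trans H; apply: ler_sum => k _; rewrite ger0_norm //.
have [a0 [abk b1]] := ab k.
exact: le_trans (variation_from0_incr fac a0 abk b1).
Qed.

End AbsContVariation.

(** * Lebesgue-Stieltjes measure and density of a monotone function *)

Section MonotoneRN.
Variable R : realType.
Let lam := @lebesgue_measure R.

(** The retraction of the line onto [[0, 1]]. Composing with it extends a function by constants, as
    a cumulative function has to be defined on the whole line. *)
Definition clamp01 (x : R) := Num.min 1 (Num.max 0 x).

Lemma clamp01_itv x : 0 <= clamp01 x <= 1.
Proof. by rewrite /clamp01 ge_min lexx /= le_min ler01 le_max lexx. Qed.

Lemma clamp01_id x : 0 <= x <= 1 -> clamp01 x = x.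
Proof. by move=> /andP[x0 x1]; rewrite /clamp01 max_r // min_r. Qed.

Lemma clamp01_le x y : x <= y -> clamp01 x <= clamp01 y.
Proof.
move=> xy; rewrite /clamp01 le_min ge_min lexx /= ge_min.
by rewrite ge_max !le_max lexx /= xy !orbT.
Qed.

Lemma clamp01_lip x y : x <= y -> clamp01 y - clamp01 x <= y - x.
Proof.
rewrite /clamp01 => ?; have := @ler01 R.
by case: (leP 0 x) => ?; case: (leP 0 y) => ?; rewrite ?(min_r ler01);
  case: (leP 1 x) => ?; case: (leP 1 y) => ?; lra.
Qed.

Variable g : R -> R.
Hypothesis gac : abs_cont01 g.
Hypothesis gnd : forall x y, 0 <= x -> x <= y -> y <= 1 -> g x <= g y.

Let G x := g (clamp01 x).

Let Gnd : {homo G : x y / x <= y}.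
Proof.
move=> x y xy; apply: gnd; last by have /andP[] := clamp01_itv y.
  by have /andP[] := clamp01_itv x.
exact: clamp01_le.
Qed.

Let Gcont : continuous G.
Proof.
move=> x; apply/cvgrPdist_lt => e e0.
have [d d0 dP] := abs_cont01_ltr gac e0.
near=> y; apply: dP; [exact: clamp01_itv|exact: clamp01_itv|].
apply: (@le_lt_trans _ _ `|x - y|); last first.
  by near: y; exact: cvgr_dist_lt.
have [xy|/ltW xy] := leP x y.
  rewrite distrC ger0_norm ?subr_ge0 ?clamp01_le //.
  by rewrite (distrC x) ger0_norm ?subr_ge0 // clamp01_lip.
rewrite ger0_norm ?subr_ge0 ?clamp01_le //.
by rewrite ger0_norm ?subr_ge0 // clamp01_lip.
Unshelve. all: by end_near. Qed.

Let Gc : cumulative R R :=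
  HB.pack G (isCumulative.Build R _ R G Gnd (right_continuousW Gcont)).

Let mu : {measure set (measurableTypeR R) -> \bar R} :=
  lebesgue_stieltjes_measure Gc.

Let mu_oc a b : a <= b -> mu `]a, b]%classic = (G b - G a)%:E.
Proof.
move=> ab; rewrite /mu /= /lebesgue_stieltjes_measure /measure_extension.
by rewrite measurable_mu_extE/= ?wlength_itv_bnd//; exact: is_ocitv.
Qed.

(** Outer regularity encloses [A] in an open set of Lebesgue measure below [d]. Its components are
    disjoint intervals, and absolute continuity makes the increments of [g] over finitely many of
    them sum to less than [e]. *)
Let mu_null (A : set R) : measurable A -> A `<=` `]-1, 2[%classic -> lam A = 0 -> mu A = 0.
Proof.
move=> mA A12 A0; apply/eqP; rewrite eq_le measure_ge0 andbT.
apply/lee_addgt0Pr => e e0; rewrite add0e.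
have [d d0 dP] := abs_cont01_family gac e0.
have [U [oU AU UAd]] : exists U : set R,
    [/\ open U, A `<=` U & (lam (U `\` A) < d%:E)%E].
  have Afin : (lam A < +oo)%E by rewrite A0 ltry.
  exact: lebesgue_regularity_outer.
(* Intersecting with a bounded interval makes every component bounded, so that its infimum and
   supremum are its endpoints. *)
pose W := U `&` `]-1, 2[%classic.
have oW : open W by apply: openI => //; exact: interval_open.
have mW : measurable W by exact: open_measurable.
have mU : measurable U by exact: open_measurable.
have lamW : (lam W < d%:E)%E.
  apply: le_lt_trans UAd.
  apply: (@le_trans _ _ (lam ((U `\` A) `|` A))).
    apply: le_measure; rewrite ?inE //.
      by apply: measurableU => //; exact: measurableD.
    by move=> x [Ux _]; have [Ax|nAx] := pselect (A x); [right|left].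
  rewrite (le_trans (measureU2 _ _ _)) //; first exact: measurableD.
  by rewrite [X in (_ + X)%E](_ : _ = 0) ?adde0.
pose I := open_disjoint_itv oW.
have WI : W = \bigcup_q I q := open_disjoint_itv_bigcup oW.
have oI k : open (I k) by exact: open_disjoint_itv_open.
have tI : trivIset setT I by exact: open_disjoint_itv_trivIset.
have mI k : measurable (I k) by exact: open_measurable.
have I12 k : I k `<=` `]-1, 2[%classic.
  move=> x Ix; have : W x by rewrite WI; exists k.
  by case.
pose c k := inf (I k); pose h k := sup (I k).
have IE k : I k = `]c k, h k[%classic.
  rewrite -{1}((interior_id (I k)).1 (oI k)) interval_bounded_interior //.
  - exact: open_disjoint_itv_is_interval.
  - by exists (-1) => x /I12; rewrite /= in_itv /= => /andP[/ltW].
  - by exists 2 => x /I12; rewrite /= in_itv /= => /andP[_ /ltW].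
(* The enumeration may contain empty components; their endpoints take the default value 0. *)
have Ie k : I k = set0 -> c k = 0 /\ h k = 0.
  by move=> E; rewrite /c /h E inf0 sup0.
have ch k : c k <= h k.
  have [/Ie[-> ->] //|/set0P[x]] := eqVneq (I k) set0.
  by rewrite IE /= in_itv /= => /andP[cx xh]; exact: ltW (lt_trans cx xh).
have lamI k : lam (I k) = (h k - c k)%:E.
  rewrite IE /lam lebesgue_measure_itv /= lte_fin.
  by case: ltgtP (ch k) => // ->; rewrite subrr.
have muI k : (mu (I k) <= (G (h k) - G (c k))%:E)%E.
  rewrite -mu_oc //; apply: le_measure; rewrite ?inE;
    [exact: mI|exact: measurable_itv|].
  by rewrite IE => x /=; rewrite !in_itv /= => /andP[-> /ltW].
apply: (@le_trans _ _ (mu W)).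
  apply: le_measure; rewrite ?inE; [exact: mA|exact: mW|].
  by move=> x Ax; split; [exact: AU|exact: A12].
(* By countable additivity only finite partial sums need a bound. *)
rewrite WI measure_semi_bigcup //; last by rewrite -WI.
apply: lime_le; first exact: is_cvg_nneseries.
near=> N; rewrite big_mkord.
apply: (@le_trans _ _ (\sum_(k < N) (G (h k) - G (c k))%:E)%E).
  by apply: lee_sum => k _; exact: muI.
rewrite sumEFin lee_fin; apply: ltW.
apply: (le_lt_trans _ (dP 'I_N (fun k => clamp01 (c k)) (fun k => clamp01 (h k)) _ _)).
- by apply: ler_sum => k _; exact: ler_norm.
- split=> [k|k l kl].
    have /andP[? _] := clamp01_itv (c k); have /andP[_ ?] := clamp01_itv (h k).
    by split=> //; split=> //; exact: clamp01_le.
  have [/Ie[c0 h0]|/set0P[x]] := eqVneq (I k) set0.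
    left; rewrite h0 clamp01_id ?lexx ?ler01 //.
    by have /andP[] := clamp01_itv (c l).
  have [/Ie[c0 h0]|/set0P[y]] := eqVneq (I l) set0.
    right; rewrite h0 clamp01_id ?lexx ?ler01 //.
    by have /andP[] := clamp01_itv (c k).
  rewrite !IE /= !in_itv /= => /andP[cly yhl] /andP[ckx xhk].
  have [hc|ch1] := leP (h k) (c l); first by left; exact: clamp01_le.
  have [hc|ch2] := leP (h l) (c k); first by right; exact: clamp01_le.
  (* If neither interval preceded the other, they would share the midpoint [z] of their overlap,
     against disjointness. *)
  exfalso; pose z := (Num.max (c k) (c l) + Num.min (h k) (h l)) / 2.
  have : Num.max (c k) (c l) < Num.min (h k) (h l).
    by rewrite lt_min !gt_max (lt_trans ckx xhk) (lt_trans cly yhl) ch1 ch2.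
  move=> /midf_lt[]; rewrite -/z gt_max lt_min => /andP[zk zl] /andP[zk' zl'].
  have : (I k `&` I l) z by split; rewrite IE /= in_itv /= ?zk ?zl.
  have kl' : nat_of_ord k != nat_of_ord l by rewrite (inj_eq val_inj).
  by move/trivIsetP : tI => /(_ k l Logic.I Logic.I kl') ->.
- rewrite -lte_fin; apply: le_lt_trans lamW.
  apply: (@le_trans _ _ (\sum_(k < N) lam (I k))%E).
    rewrite -sumEFin; apply: lee_sum => k _; rewrite lamI lee_fin.
    exact: clamp01_lip.
  rewrite WI /lam measure_semi_bigcup //; last by rewrite -WI.
  rewrite -(big_mkord xpredT (fun k => lam (I k))); exact: nneseries_lim_ge.
Unshelve. all: by end_near. Qed.

(** Restriction to []0, 1]] gives the finite measure to which the Radon-Nikodym theorem is applied,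
    and keeps null sets within the range of [mu_null]. *)
Let D01 : set (measurableTypeR R) := `]0, 1]%classic.
Let mD01 : measurable D01. Proof. exact: measurable_itv. Qed.
Let muD01 : (mu D01 < +oo)%E. Proof. by rewrite mu_oc // ltry. Qed.
Let nu : {finite_measure set (measurableTypeR R) -> \bar R} := mfrestr mD01 muD01.

Let nu_lam : nu `<< lam.
Proof.
move=> A A0 B mB BA; rewrite /nu /= /mfrestr /mrestr.
apply: mu_null; first exact: measurableI.
  by move=> x [_]; rewrite /D01 /= !in_itv /= => /andP[? ?]; apply/andP; split; lra.
apply: (A0 (B `&` D01)); first exact: measurableI.
by move=> x [/BA].
Qed.

Lemma abs_cont01_monotone_density : exists rho : R -> R,
  lam.-integrable setT (EFin \o rho) /\
  forall a b, 0 <= a -> a <= b -> b <= 1 ->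
    (g b - g a)%:E = (\int[lam]_(t in `]a, b]) (rho t)%:E)%E.
Proof.
pose r := Radon_Nikodym (charge_of_finite_measure nu) lam.
have rE x : r x = (fine (r x))%:E.
  by rewrite fineK //; exact: Radon_Nikodym_fin_num.
exists (fine \o r); split.
  apply: (eq_integrable measurableT r) => [x _|]; first by rewrite /= -rE.
  exact: Radon_Nikodym_integrable.
move=> a b a0 ab b1.
under eq_integral do rewrite /= -rE.
rewrite -Radon_Nikodym_integral //.
rewrite /= /nu /= /mfrestr /mrestr setIidl; last first.
  move=> x; rewrite /= !in_itv /= => /andP[ax xb].
  by apply/andP; split; [exact: le_lt_trans a0 ax|exact: le_trans xb b1].
by rewrite mu_oc // /G !clamp01_id ?a0 ?b1 ?(le_trans a0 ab) ?(le_trans ab b1).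
Qed.

End MonotoneRN.

(** * Density and almost everywhere derivative *)

Section AbsContDensity.
Variable R : realType.
Let lam := @lebesgue_measure R.

(** Jordan decomposition: [f] is its variation function minus the difference of that function and
    [f]. Both terms are nondecreasing and absolutely continuous, so each has a density. *)
Lemma abs_cont01_density (f : R -> R) : abs_cont01 f -> exists rho : R -> R,
  lam.-integrable setT (EFin \o rho) /\
  forall a b, 0 <= a -> a <= b -> b <= 1 ->
    (f b - f a)%:E = (\int[lam]_(t in `]a, b]) (rho t)%:E)%E.
Proof.
move=> fac; have vac := abs_cont01_variation fac.
have [|r1 [ir1 r1E]] := abs_cont01_monotone_density vac.
  move=> x y x0 xy y1; rewrite -subr_ge0.
  exact: le_trans (variation_from0_incr fac x0 xy y1).
have [|r2 [ir2 r2E]] := abs_cont01_monotone_density (abs_cont01B vac fac).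
  move=> x y x0 xy y1; rewrite -subr_ge0.
  have := le_trans (ler_norm _) (variation_from0_incr fac x0 xy y1).
  by lra.
exists (fun x => r1 x - r2 x); split.
  rewrite (_ : _ \o _ = (EFin \o r1) \- (EFin \o r2))%E //.
  exact: integrableB.
move=> a b a0 ab b1.
under eq_integral do rewrite EFinB.
have sub r : lam.-integrable setT (EFin \o r) ->
    lam.-integrable `]a, b]%classic (EFin \o r).
  by apply: integrableS => //; exact: measurable_itv.
rewrite integralB; [|exact: measurable_itv|exact: sub|exact: sub].
rewrite -r1E // -r2E // -EFinB; congr EFin; ring.
Qed.

(** Lebesgue differentiation, applied to the indefinite integral [F] of the density. *)
Lemma abs_cont01_derivable (f : R -> R) : abs_cont01 f -> exists rho : R -> R,
  [/\ lam.-integrable setT (EFin \o rho),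
  (forall a b, 0 <= a -> a <= b -> b <= 1 ->
    (f b - f a)%:E = (\int[lam]_(t in `]a, b]) (rho t)%:E)%E) &
  {ae lam, forall t, 0 < t < 1 -> derivable f t 1 /\ derive1 f t = rho t}].
Proof.
move=> /abs_cont01_density[rho [irho rhoE]]; exists rho; split => //.
have loc : locally_integrable setT rho by apply: open_integrable_locally; first exact: openT.
have ioc y : lam.-integrable [set` Interval (BRight 0) (BRight y)] (EFin \o rho).
  by apply: integrableS irho => //; exact: measurable_itv.
have := FTC1 ioc loc; set F := fun x => _ => /=.
apply: filterS; first exact: (ae_filter_ringOfSetsType (@lebesgue_measure R)).
move=> t H /andP[t0 t1]; have [|dF FE] := H; first exact: t0.
(* Near an interior point [f] is [F] plus the constant [f 0], so both have the same derivative
   there. *)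
have eqF : \forall s \near t, (F s + f 0) = f s.
  have : t \in `]0, 1[ by rewrite in_itv /= t0 t1.
  move=> /near_in_itvoo; apply: filterS => s; rewrite in_itv /= => /andP[s0 s1].
  rewrite /F /Rintegral -[X in fine X](rhoE 0 s (lexx _) (ltW s0) (ltW s1)) /=.
  by rewrite addrNK.
split.
  apply: (near_eq_derivable eqF).
  exact: derivableD.
rewrite derive1E -(near_eq_derive _ eqF) deriveD //.
by rewrite derive_cst addr0 -derive1E.
Qed.

End AbsContDensity.

(** * Quadratic forms on matrices *)

Section TraceForm.
Variables (R : realType) (n : nat) (S : 'M[R]_n).
Implicit Types M W : 'M[R]_n.

Definition trform M W : R := \tr (M *m S *m W^T).

(** Displays the form as a linear combination of the entries of [M], the shape in which it commutes
    with an entrywise integral. *)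
Lemma trformE M W : trform M W = \sum_i \sum_j M i j * (W *m S^T) i j.
Proof.
rewrite /trform -mulmxA -{1}(trmxK S) -trmx_mul /mxtrace.
by apply: eq_bigr => i _; rewrite mxE; apply: eq_bigr => j _; rewrite mxE.
Qed.

Lemma trformDl M M' W : trform (M + M') W = trform M W + trform M' W.
Proof. by rewrite /trform !mulmxDl mxtraceD. Qed.

Lemma trformZl c M W : trform (c *: M) W = c * trform M W.
Proof. by rewrite /trform -!scalemxAl mxtraceZ. Qed.

Lemma trformZr c M W : trform M (c *: W) = c * trform M W.
Proof. by rewrite /trform linearZ /= -!scalemxAr mxtraceZ. Qed.

Lemma trformDr M W W' : trform M (W + W') = trform M W + trform M W'.
Proof. by rewrite /trform linearD /= mulmxDr mxtraceD. Qed.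

Hypothesis Spd : symPD S.

Lemma trformC M W : trform M W = trform W M.
Proof.
by rewrite /trform -mxtrace_tr !trmx_mul trmxK (proj1 Spd) mulmxA.
Qed.

Lemma trform_ge0 M : 0 <= trform M M.
Proof.
rewrite /trform /mxtrace; apply: sumr_ge0 => i _.
(* Each diagonal entry is the quadratic form of [S] at a row of [M]. *)
have -> : (M *m S *m M^T) i i = (((row i M)^T)^T *m S *m (row i M)^T) 0 0.
  rewrite trmxK -row_mul !mxE; apply: eq_bigr => j _.
  by rewrite !mxE.
have [->|/Spd.2/ltW //] := eqVneq ((row i M)^T) 0.
by rewrite mulmx0 mxE.
Qed.

(** Nonnegativity of the form at [M - W]: the form lies above its tangent at [W]. This affine lower
    bound yields both coercivity and Jensen's inequality. *)
Lemma trform_tangent M W : 2 * trform M W - trform W W <= trform M M.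
Proof.
have := trform_ge0 (M + (-1) *: W).
rewrite !(trformDl, trformDr, trformZl, trformZr) (trformC W M); lra.
Qed.

Lemma symPD_unitmx : S \in unitmx.
Proof.
rewrite -row_free_unit; apply: inj_row_free => v vS.
apply/eqP/negPn/negP => v0.
have /(Spd.2) : v^T != 0 by rewrite -(inj_eq trmx_inj) trmxK trmx0.
by rewrite trmxK vS mul0mx mxE ltxx.
Qed.

(** The tangent inequality at a multiple of [delta_mx i j *m invmx S] isolates the entry [M i j],
    because [S] cancels its inverse. No eigenvalues enter. *)
Lemma trform_coercive : exists2 c : R, 0 < c &
  forall M i j, M i j ^+ 2 <= c * trform M M.
Proof.
pose s j := invmx S j j.
have TS W : (W *m invmx S *m S) = W by rewrite mulmxKV // symPD_unitmx.
have ST W : S *m (W *m invmx S)^T = W^T.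
  by rewrite -{1}(proj1 Spd) -trmx_mul TS.
have main M i j : forall x, 2 * x * M i j - x ^+ 2 * s j <= trform M M.
  move=> x; have := trform_tangent M (x *: (delta_mx i j *m invmx S)).
  rewrite !(trformZl, trformZr).
  have -> : trform M (delta_mx i j *m invmx S) = M i j.
    rewrite /trform -mulmxA ST trmx_delta /mxtrace (bigD1 i) //= big1 ?addr0.
      rewrite mxE (bigD1 j) //= big1 ?addr0 ?mxE ?eqxx ?mulr1 // => k kj.
      by rewrite mxE (negPf kj) mulr0.
    move=> k ki; rewrite mxE big1 // => l _.
    by rewrite mxE (negPf ki) andbF mulr0.
  have -> : trform (delta_mx i j *m invmx S) (delta_mx i j *m invmx S) = s j.
    rewrite /trform -mulmxA ST trmx_delta /mxtrace (bigD1 i) //= big1 ?addr0.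
      rewrite mxE (bigD1 j) //= big1 ?addr0.
        rewrite mxE (bigD1 j) //= big1 ?addr0 ?mxE ?eqxx ?mulr1 ?mul1r // => k kj.
        by rewrite mxE (negPf kj) andbF mul0r.
      by move=> k kj; rewrite [X in _ * X]mxE (negPf kj) mulr0.
    move=> k ki; rewrite mxE big1 // => l _.
    by rewrite [X in _ * X]mxE (negPf ki) andbF mulr0.
  by rewrite expr2 !mulrA.
(* [c] is positive and dominates every diagonal entry of the inverse of [S]. *)
pose c := 1 + \sum_j `|s j|.
have c0 : 0 < c by rewrite ltr_wpDr // sumr_ge0.
exists c => // M i j.
have sc : s j <= c.
  rewrite /c (bigD1 j) //= addrCA (le_trans (ler_norm _)) // lerDl addr_ge0 //.
  exact: sumr_ge0.
(* The optimal [x] would be [M i j / s j]; putting [c] for [s j] makes the constant independent of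
   the entry. *)
have := main M i j (M i j / c).
have : (M i j / c) ^+ 2 * s j <= (M i j / c) ^+ 2 * c by rewrite ler_wpM2l ?sqr_ge0.
have -> : (M i j / c) ^+ 2 * c = M i j ^+ 2 / c by field; rewrite gt_eqF.
have -> : 2 * (M i j / c) * M i j = 2 * (M i j ^+ 2 / c) by field; rewrite gt_eqF.
move=> h1 h2; rewrite -ler_pdivrMl // mulrC; lra.
Qed.

End TraceForm.

(** * Integration of matrix functions and Jensen's inequality *)

Section Energy.
Variable R : realType.
Let lam := @lebesgue_measure R.

Lemma integral_lincomb (D : set (measurableTypeR R)) (I : Type) (s : seq I) (f : I -> R -> R)
    (x c : I -> R) : measurable D ->
  (forall p, lam.-integrable D (EFin \o f p)) ->
  (forall p, (\int[lam]_(t in D) (f p t)%:E)%E = (x p)%:E) ->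
  lam.-integrable D (fun t => (\sum_(p <- s) f p t * c p)%:E) /\
  (\int[lam]_(t in D) (\sum_(p <- s) f p t * c p)%:E)%E =
    (\sum_(p <- s) x p * c p)%:E.
Proof.
move=> mD fi fx; elim: s => [|p s [ih1 ih2]].
  under eq_fun do rewrite big_nil; rewrite big_nil.
  by split; [exact: integrable0|rewrite integral0].
have ip : lam.-integrable D (fun t => ((c p)%:E * (f p t)%:E)%E).
  exact: (integrableZl mD (c p) (fi p)).
have E : (fun t => (\sum_(q <- p :: s) f q t * c q)%:E) =
    ((fun t => ((c p)%:E * (f p t)%:E)%E) \+ (fun t => (\sum_(q <- s) f q t * c q)%:E))%E.
  by apply/funext => t /=; rewrite big_cons EFinD mulrC.
rewrite E; split; first exact: integrableD.
rewrite integralD // ih2 (integralZl mD (fi p)).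
by rewrite [X in (_ * X)%E](fx p) big_cons EFinD -EFinM mulrC.
Qed.

Lemma abs_cont01_continuous (f : R -> R) : abs_cont01 f ->
  {within `[0, 1], continuous f}.
Proof.
move=> fac; apply/subspace_continuousP => x /=; rewrite in_itv /= => x01.
apply/cvgrPdist_lt => e e0.
have [d d0 dP] := abs_cont01_ltr fac e0.
rewrite near_withinE; near=> y => /=; rewrite in_itv /= => y01.
by apply: dP => //; near: y; exact: cvgr_dist_lt.
Unshelve. all: by end_near. Qed.

Lemma measurable_mulmx (D : set R) m n p (A : R -> 'M[R]_(m, n)) (B : R -> 'M[R]_(n, p)) :
  (forall i j, measurable_fun D (fun t => A t i j)) ->
  (forall i j, measurable_fun D (fun t => B t i j)) ->
  forall i j, measurable_fun D (fun t => (A t *m B t) i j).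
Proof.
move=> mA mB i j; under eq_fun do rewrite mxE.
by apply: measurable_sum => k; exact: measurable_funM.
Qed.

Lemma measurable_trform (D : set R) n (S : 'M[R]_n) (A B : R -> 'M[R]_n) :
  (forall i j, measurable_fun D (fun t => A t i j)) ->
  (forall i j, measurable_fun D (fun t => B t i j)) ->
  measurable_fun D (fun t => trform S (A t) (B t)).
Proof.
move=> mA mB; apply: measurable_sum => i; apply: measurable_mulmx => [k l|k l].
  by apply: measurable_mulmx => // ? ?; exact: measurable_cst.
by under eq_fun do rewrite mxE; exact: mB.
Qed.

(* Jensen's inequality, through the tangent inequality at the mean value. *)
Lemma trform_integral_le n (S : 'M[R]_n) (v : R -> 'M[R]_n) (a b : R) (D : 'M[R]_n) :
  symPD S -> a < b ->
  (forall i j, lam.-integrable `]a, b]%classic (fun t => (v t i j)%:E)) ->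
  (forall i j, (\int[lam]_(t in `]a, b]) (v t i j)%:E)%E = (D i j)%:E) ->
  lam.-integrable `]a, b]%classic (fun t => (trform S (v t) (v t))%:E) ->
  (((b - a)^-1 * trform S D D)%:E <=
    \int[lam]_(t in `]a, b]) (trform S (v t) (v t))%:E)%E.
Proof.
move=> Spd ab vi vE iq; have mab : measurable (`]a, b]%classic : set (measurableTypeR R)) by exact: measurable_itv.
have ba0 : b - a != 0 by rewrite gt_eqF // subr_gt0.
have lamab : lam `]a, b]%classic = (b - a)%:E.
  by rewrite /lam lebesgue_measure_itv /= lte_fin ab.
pose W : 'M[R]_n := (b - a)^-1 *: D.
have [i1 e1] := @integral_lincomb `]a, b]%classic _ (index_enum ('I_n * 'I_n)%type)
  (fun p t => v t p.1 p.2) (fun p => D p.1 p.2) (fun p => 2 * (W *m S^T) p.1 p.2)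
  mab (fun p => vi p.1 p.2) (fun p => vE p.1 p.2).
have linE (M : 'M[R]_n) : \sum_(p : 'I_n * 'I_n) M p.1 p.2 * (2 * (W *m S^T) p.1 p.2) = 2 * trform S M W.
  rewrite trformE pair_big /= mulr_sumr; apply: eq_bigr => p _.
  by rewrite mulrCA.
have i2 : lam.-integrable `]a, b]%classic (fun t => (trform S W W)%:E).
  apply/integrableP; split; first exact: measurable_cst.
  rewrite integral_cst // [X in (_ * X)%E]lamab.
  exact: ltry.
have {}i1 : lam.-integrable `]a, b]%classic (fun t => (2 * trform S (v t) W)%:E).
  by apply: eq_integrable i1 => // t _; rewrite linE.
have {}e1 : (\int[lam]_(t in `]a, b]) (2 * trform S (v t) W)%:E)%E =
    (2 * trform S D W)%:E.
  by rewrite -linE -e1; apply: eq_integral => t _; rewrite linE.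
apply: (@le_trans _ _ (\int[lam]_(t in `]a, b])
    ((2 * trform S (v t) W)%:E - (trform S W W)%:E))%E); last first.
  apply: le_integral => //; first exact: integrableB.
  by move=> t _; rewrite -EFinB lee_fin; exact: trform_tangent.
(* At the mean value [W] the two terms are twice and once the left-hand side, so their difference
   equals it. *)
rewrite integralB // e1 integral_cst // [X in (_ - _ * X)%E]lamab -EFinM.
rewrite -EFinB lee_fin /W !(trformZl, trformZr).
by rewrite le_eqVlt; apply/orP; left; apply/eqP; field.
Qed.

End Energy.

(** * Finite-difference energy of admissible curves *)

Section AdmissibleEnergy.
Variable R : realType.
Let lam := @lebesgue_measure R.

(* By a theorem of F. Riesz, boundedness of these sums characterises the curves
   with square-integrable derivative, and, unlike the integral of the squared
   derivative, it passes to pointwise limits at once. *)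
Definition energy_le n (S : 'M[R]_n) (Phi : R -> 'M[R]_n) (C : R) : Prop :=
  forall (I : finType) (a b : I -> R), disjoint_family a b ->
    \sum_k (b k - a k)^-1 *
      trform S (Phi (b k) - Phi (a k)) (Phi (b k) - Phi (a k)) <= C.

Lemma J_KE_trform n (S : 'M[R]_n) (K Phi : R -> 'M[R]_n) :
  J_KE S K Phi = ((2^-1)%:E * \int[lam]_(t in `[0%R, 1%R])
    (trform S (K t *m Phi t) (K t *m Phi t))%:E)%E.
Proof.
rewrite /J_KE; congr (_ * _)%E; apply: eq_integral => t _.
by rewrite /trform trmx_mul !mulmxA.
Qed.

Lemma abs_cont01_measurable (f : R -> R) : abs_cont01 f ->
  measurable_fun (`[0, 1] : set R) f.
Proof.
move=> /abs_cont01_continuous fc.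
by apply: subspace_continuous_measurable_fun => //; exact: measurable_itv.
Qed.

(** Jensen's inequality on each interval, then additivity over the disjoint union, which lies in
    [[0, 1]]. *)
Lemma sum_trform_integral_le n (S : 'M[R]_n) (Phi v : R -> 'M[R]_n) (C : R) :
  symPD S ->
  (forall i j, lam.-integrable setT (fun t => (v t i j)%:E)) ->
  (forall i j a b, 0 <= a -> a <= b -> b <= 1 ->
     ((Phi b - Phi a) i j)%:E = (\int[lam]_(t in `]a, b]) (v t i j)%:E)%E) ->
  (\int[lam]_(t in `[0%R, 1%R]) (trform S (v t) (v t))%:E <= C%:E)%E ->
  energy_le S Phi C.
Proof.
move=> Spd vi vE qC I a b [ab dab].
have mv i j : measurable_fun setT (fun t => v t i j).
  by have /measurable_int /measurable_EFinP := vi i j.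
pose q t := trform S (v t) (v t).
have mq : measurable_fun (setT : set R) q by exact: measurable_trform.
have q0 t : 0 <= q t by exact: trform_ge0.
have mqD (D : set (measurableTypeR R)) : measurable_fun D (EFin \o q).
  by apply/measurable_EFinP; exact: measurable_funTS.
have iq : lam.-integrable `[0, 1]%classic (EFin \o q).
  apply/integrableP; split; first exact: mqD.
  under eq_integral do rewrite /= ger0_norm //.
  exact: le_lt_trans qC (ltry _).
(* Half-open intervals stay disjoint when neighbours share an endpoint. *)
pose F k := `]a k, b k]%classic : set (measurableTypeR R).
have mF k : measurable (F k) by exact: measurable_itv.
have F01 k : F k `<=` `[0, 1]%classic.
  have [a0 [_ b1]] := ab k.
  move=> t; rewrite /F /= !in_itv /= => /andP[at_ tb].
  by rewrite (ltW (le_lt_trans a0 at_)) (le_trans tb b1).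
rewrite -lee_fin; apply: le_trans qC.
apply: (@le_trans _ _ (\sum_(k <- index_enum I) \int[lam]_(t in F k) (q t)%:E)%E).
  rewrite -sumEFin; apply: lee_sum => k _; have [a0 [abk b1]] := ab k.
  (* A degenerate interval contributes 0, since the inverse of 0 is 0. *)
  move: abk; rewrite le_eqVlt => /predU1P[->|abk].
    by rewrite subrr invr0 mul0r integral_ge0 // => t _; rewrite lee_fin.
  apply: trform_integral_le => //.
  - by move=> i j; apply: integrableS (vi i j) => //; exact: mF.
  - by move=> i j; rewrite -vE // ltW.
  - by apply: integrableS iq; [exact: measurable_itv|exact: mF|exact: F01].
rewrite -ge0_integral_bigsetU //; last 3 first.
- exact: index_enum_uniq.
- apply/trivIsetP => k l _ _ kl; apply/seteqP; split => // t.
  rewrite /F /= !in_itv /= => -[/andP[kt tk] /andP[lt_ tl]].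
  have [h|h] := dab k l kl.
    by have := lt_le_trans lt_ (le_trans tk h); rewrite ltxx.
  by have := lt_le_trans kt (le_trans tl h); rewrite ltxx.
- by move=> t _; rewrite lee_fin.
apply: ge0_subset_integral => //.
- by apply: bigsetU_measurable => k _; exact: mF.
- by move=> t _; rewrite lee_fin.
- by rewrite -bigcup_seq; apply: bigcup_sub => k _; exact: F01.
Qed.

(** The velocity [K t *m Phi t] agrees almost everywhere with the matrix [v] of densities of the
    entries of [Phi], so its energy controls the increments of [Phi]. *)
Lemma admissible_energy n m (Sigma : R -> 'M[R]_n) (Y0 Y1 : 'M[R]_(n, m))
    (K Phi : R -> 'M[R]_n) (C : R) :
  symPD (Sigma 0) -> admissible Sigma Y0 Y1 K Phi ->
  (J_KE (Sigma 0%R) K Phi <= C%:E)%E -> energy_le (Sigma 0) Phi (2 * C).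
Proof.
move=> Spd [Ksq [Pac [_ [_ [Pd _]]]]]; rewrite J_KE_trform => JC.
have [rho rhoP] := choice (fun p : 'I_n * 'I_n => abs_cont01_derivable (Pac p.1 p.2)).
pose v t : 'M[R]_n := \matrix_(i, j) rho (i, j) t.
pose u t : 'M[R]_n := K t *m Phi t.
have vi i j : lam.-integrable setT (fun t => (v t i j)%:E).
  have [h _ _] := rhoP (i, j).
  by apply: eq_integrable h => // t _; rewrite /v mxE.
have mv i j : measurable_fun setT (fun t => v t i j).
  by have /measurable_int /measurable_EFinP := vi i j.
have mu_ i j : measurable_fun (`[0, 1] : set R) (fun t => u t i j).
  apply: measurable_mulmx => k l; first by have [] := Ksq k l.
  exact: abs_cont01_measurable.
have aeuv : {ae lam, forall t, 0 < t < 1 -> u t = v t}.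
  (* The differential equation needs all entries differentiable at the same point; as they are
     finitely many, almost every point qualifies. *)
  have : {ae lam, forall t, forall p : 'I_n * 'I_n, 0 < t < 1 ->
      derivable (fun s => Phi s p.1 p.2) t 1 /\
      derive1 (fun s => Phi s p.1 p.2) t = rho p t}.
    apply: (@filter_forall _ _ _ (almost_everywhere (@lebesgue_measure R))
      (ae_filter_ringOfSetsType (@lebesgue_measure R))).
    by move=> p; have [] := rhoP p.
  apply: filterS; first exact: (ae_filter_ringOfSetsType (@lebesgue_measure R)).
  move=> t H t01; apply/matrixP => i j.
  rewrite /u /v mxE -Pd //; first by have [] := H (i, j) t01.
  by move=> k l; have [] := H (k, l) t01.
have mo (w : R -> 'M[R]_n) :
    (forall i j, measurable_fun (`[0, 1] : set R) (fun t => w t i j)) ->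
    measurable_fun (`]0, 1[ : set R) (fun t => (trform (Sigma 0) (w t) (w t))%:E).
  move=> mw; apply/measurable_EFinP.
  have h := measurable_trform (Sigma 0) mw mw.
  apply: measurable_funS h; first exact: measurable_itv.
  by move=> t /=; rewrite !in_itv /= => /andP[/ltW -> /ltW ->].
apply: (@sum_trform_integral_le _ _ _ v) => //.
  move=> i j a b a0 ab b1; have [_ h _] := rhoP (i, j).
  have -> : (Phi b - Phi a) i j = Phi b i j - Phi a i j by rewrite !mxE.
  rewrite h //.
  by apply: eq_integral => t _; rewrite /v mxE.
have mv01 i j : measurable_fun (`[0, 1] : set R) (fun t => v t i j).
  exact: measurable_funTS.
(* The equation is known only inside []0, 1[]; the endpoints do not affect the integrals. *)
rewrite integral_itv_bndoo; last exact: mo.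
have E : (\int[lam]_(t in `]0%R, 1%R[) (trform (Sigma 0) (v t) (v t))%:E =
    \int[lam]_(t in `]0%R, 1%R[) (trform (Sigma 0) (u t) (u t))%:E)%E.
  apply: ae_eq_integral; [exact: measurable_itv|exact: mo|exact: mo|].
  apply: filterS aeuv; first exact: (ae_filter_ringOfSetsType (@lebesgue_measure R)).
  by move=> t /[swap]; rewrite /= in_itv /= => t01 /(_ t01) ->.
rewrite [leLHS]E -[leLHS](@integral_itv_bndoo _ _ _ _ true false); last exact: mo.
by rewrite EFinM muleC -lee_pdivrMr // muleC.
Qed.

End AdmissibleEnergy.

(** * Curves of finite energy *)

Section FiniteEnergy.
Variable R : realType.

Lemma energy_le_ge0 n (S : 'M[R]_n) Phi C : energy_le S Phi C -> 0 <= C.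
Proof.
move=> /(_ 'I_0 (fun=> 0) (fun=> 0)); rewrite big_ord0; apply.
by split=> -[].
Qed.

(** A weighted arithmetic-geometric mean inequality, summed over the intervals, bounds twice the sum
    of the increments of an entry by [s * (c * C)] plus the total length divided by [s]. *)
Lemma energy_le_abs_cont n (S : 'M[R]_n) Phi C i j : symPD S ->
  energy_le S Phi C -> abs_cont01 (fun t => Phi t i j).
Proof.
move=> Spd PC e e0; have C0 := energy_le_ge0 PC.
have [c c0 cP] := trform_coercive Spd.
(* This weight makes the energy term at most [e / 2]; the added 1 keeps the denominator positive
   when [c * C] vanishes. *)
pose s := e / (2 * (c * C + 1)).
have cC0 : 0 <= c * C by rewrite mulr_ge0 // ltW.
have s0 : 0 < s by rewrite divr_gt0 // mulr_gt0 // ltr_wpDl.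
have scC : s * (c * C) <= e / 2.
  rewrite /s invfM !mulrA -[leRHS]mulr1 -!mulrA ler_pM2l // ler_pM2l ?invr_gt0 //.
  by rewrite ler_pdivrMl ?mulr1 ?lerDl // ltr_wpDl.
(* With total length below [s * e], twice the sum is less than [e / 2 + e], hence less than
   [2 * e]. *)
exists (s * e) => [|N a b ab dab sd]; first exact: mulr_gt0.
(* AM-GM: [2 |x| <= s x^2 / l + l / s] *)
have amgm k : 2 * `|Phi (b k) i j - Phi (a k) i j| <=
    s * c * ((b k - a k)^-1 * trform S (Phi (b k) - Phi (a k)) (Phi (b k) - Phi (a k)))
    + (b k - a k) / s.
  have [a0 [abk b1]] := ab k.
  set M := Phi (b k) - Phi (a k).
  have <- : M i j = Phi (b k) i j - Phi (a k) i j by rewrite !mxE.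
  have [l0|l0] := eqVneq (b k - a k) 0.
    have -> : M = 0 by apply/eqP; rewrite subr_eq0; apply/eqP; congr Phi; lra.
    by rewrite mxE normr0 l0 invr0 !mul0r !mulr0 addr0.
  have {}l0 : 0 < b k - a k by rewrite lt_neqAle eq_sym l0 subr_ge0.
  set l := b k - a k in l0 *.
  have := cP M i j; set q := trform S M M; set x := M i j => xq.
  have h1 : s / l * x ^+ 2 <= s / l * (c * q) by rewrite ler_wpM2l // ltW // divr_gt0.
  have -> : s * c * (l^-1 * q) = s / l * (c * q) by ring.
  apply: (le_trans _ (lerD h1 (lexx _))).
  rewrite -subr_ge0 -real_normK ?num_real //.
  have -> : s / l * `|x| ^+ 2 + l / s - 2 * `|x| = s / l * (`|x| - l / s) ^+ 2.
    by field; rewrite !gt_eqF.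
  by rewrite mulr_ge0 ?sqr_ge0 // ltW // divr_gt0.
have := @ler_sum R _ (index_enum 'I_N) xpredT _ _ (fun k _ => amgm k).
rewrite -mulr_sumr big_split /= -mulr_sumr -mulr_suml => h.
have h2 := PC _ a b (conj ab dab).
have h3 : (\sum_(k < N) (b k - a k)) / s < e by rewrite ltr_pdivrMr // mulrC.
have h4 := ler_wpM2l (ltW (mulr_gt0 s0 c0)) h2.
rewrite -(ltr_pM2l (x := 2)) //; apply: (le_lt_trans h).
apply: (le_lt_trans (lerD h4 (lexx _))).
rewrite -mulrA; lra.
Qed.

(** Here [t] need not be an end of the interval. The increment is split at [t], and the two
    remainders are at most [e / 2] times [b - t] and [t - a]. *)
Lemma derivable_straddle (f : R -> R) (t e : R) : derivable f t 1 -> 0 < e ->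
  exists2 d, 0 < d & forall a b, a <= t -> t <= b -> a < b -> b - a < d ->
    `|(b - a)^-1 * (f b - f a) - derive1 f t| < e.
Proof.
move=> df e0; set L := derive1 f t.
have e20 : 0 < e / 2 by rewrite divr_gt0.
have : h^-1 *: (f (h + t) - f t) @[h --> 0^'] --> L.
  by rewrite /L derive1E /derive; under eq_fun do rewrite -[X in f (X + _)]mulr1; exact: df.
move=> /cvgrPdist_lt /(_ _ e20) /nbhs_ballP[d /= d0 dP].
(* Clearing the denominator lets the estimate include [x = t], needed when [t] is an end of the
   interval. *)
have key x : `|x - t| < d -> `|f x - f t - L * (x - t)| <= e / 2 * `|x - t|.
  move=> xt; have [->|xt0] := eqVneq x t; first by rewrite !subrr mulr0 subrr normr0 mulr0.
  have h0 : x - t != 0 by rewrite subr_eq0.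
  have := dP (x - t); rewrite /ball /= sub0r normrN subrK => /(_ xt h0) H.
  have -> : f x - f t - L * (x - t) = (x - t) * - (L - (x - t)^-1 *: (f x - f t)).
    by rewrite /GRing.scale /=; field.
  by rewrite normrM normrN mulrC ler_wpM2r // ltW.
exists d => // a b at_ tb ab bad.
have ba0 : 0 < b - a by rewrite subr_gt0.
have -> : (b - a)^-1 * (f b - f a) - L =
    (b - a)^-1 * ((f b - f t - L * (b - t)) - (f a - f t - L * (a - t))).
  by field; rewrite gt_eqF.
rewrite normrM gtr0_norm ?invr_gt0 // mulrC ltr_pdivrMr //.
apply: (le_lt_trans (ler_normB _ _)).
have Hb : `|f b - f t - L * (b - t)| <= e / 2 * (b - t).
  by rewrite -{2}(ger0_norm (_ : 0 <= b - t)) ?subr_ge0 // key // ger0_norm ?subr_ge0 //; lra.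
have Ha : `|f a - f t - L * (a - t)| <= e / 2 * (t - a).
  rewrite -(ger0_norm (_ : 0 <= t - a)) ?subr_ge0 // (distrC t) key //.
  by rewrite distrC ger0_norm ?subr_ge0 //; lra.
apply: (le_lt_trans (lerD Hb Ha)); rewrite -mulrDr addrA subrK.
by rewrite ltr_pM2r //; lra.
Qed.

End FiniteEnergy.

(** * Difference quotients on uniform grids *)

Section GridQuotients.
Variables (R : realType) (n : nat).
Implicit Types (S : 'M[R]_n) (Phi : R -> 'M[R]_n).
Let lam := @lebesgue_measure R.

Definition grid (N i : nat) : R := i%:R / N.+1%:R.

(** Half-open cells, so that those with index at most [N] partition [[0, 1[]. *)
Definition grid_cell (N i : nat) : set (measurableTypeR R) :=
  `[grid N i, grid N i.+1[%classic.

Definition grid_slope Phi (N i : nat) : 'M[R]_n :=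
  N.+1%:R *: (Phi (grid N i.+1) - Phi (grid N i)).

(** On [[0, 1[], the right derivative of the piecewise linear interpolation of [Phi] at the grid
    points; elsewhere 0. *)
Definition grid_quotient Phi (N : nat) (t : R) : 'M[R]_n :=
  \sum_(i < N.+1) \1_(grid_cell N i) t *: grid_slope Phi N i.

Lemma gridS N i : grid N i.+1 - grid N i = N.+1%:R^-1.
Proof. by rewrite /grid -mulrBl -natrB // subSnn mul1r. Qed.

Lemma grid_le N i j : (i <= j)%N -> grid N i <= grid N j.
Proof. by move=> ij; rewrite /grid ler_pM2r ?invr_gt0 // ler_nat. Qed.

Lemma grid_family N : disjoint_family (fun i : 'I_N.+1 => grid N i) (fun i => grid N i.+1).
Proof.
split=> [i|i j ij].
  split; first by rewrite /grid divr_ge0.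
  split; first exact: grid_le.
  by rewrite /grid ler_pdivrMr // mul1r ler_nat.
have [ij'|ji|/ord_inj e] := ltngtP i j; [left|right|]; try exact: grid_le.
by move: ij; rewrite e eqxx.
Qed.

Lemma grid_cellP N t : 0 <= t -> t < 1 -> exists i : 'I_N.+1, grid_cell N i t.
Proof.
move=> t0 t1.
have /truncn_itv/andP[h1 h2] : 0 <= t * N.+1%:R by rewrite mulr_ge0.
have iN : (Num.truncn (t * N.+1%:R) < N.+1)%N.
  by rewrite truncn_lt_nat ?mulr_ge0 // gtr_pMl.
exists (Ordinal iN); rewrite /grid_cell /= in_itv /= /grid.
by rewrite ler_pdivrMr // h1 ltr_pdivlMr.
Qed.

Lemma grid_cell_uniq N t (i j : 'I_N.+1) :
  grid_cell N i t -> grid_cell N j t -> i = j.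
Proof.
rewrite /grid_cell /= !in_itv /= => /andP[h1 h2] /andP[h3 h4].
have [//|ij] := eqVneq i j.
have [_ /(_ i j ij) [h|h]] := grid_family N.
  by have := lt_le_trans h2 (le_trans h h3); rewrite ltxx.
by have := lt_le_trans h4 (le_trans h h1); rewrite ltxx.
Qed.

Lemma grid_quotient_cell Phi N t (i : 'I_N.+1) : grid_cell N i t ->
  grid_quotient Phi N t = grid_slope Phi N i.
Proof.
move=> ti; rewrite /grid_quotient (bigD1 i) //= big1 ?addr0.
  by rewrite indicE mem_set // scale1r.
move=> j ji; rewrite indicE memNset ?scale0r // => tj.
by move: ji; rewrite (grid_cell_uniq ti tj) eqxx.
Qed.

Lemma grid_quotient_out Phi N t : (forall i : 'I_N.+1, ~ grid_cell N i t) ->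
  grid_quotient Phi N t = 0.
Proof.
by move=> h; rewrite /grid_quotient big1 // => i _; rewrite indicE memNset ?scale0r.
Qed.

(** At most one indicator is nonzero at [t], so no cross terms appear. *)
Lemma trform_grid_quotient S Phi N t :
  trform S (grid_quotient Phi N t) (grid_quotient Phi N t) =
  \sum_(i < N.+1) \1_(grid_cell N i) t *
    trform S (grid_slope Phi N i) (grid_slope Phi N i).
Proof.
have [[i ti]|h] := pselect (exists i : 'I_N.+1, grid_cell N i t).
  rewrite (grid_quotient_cell _ ti) (bigD1 i) //= big1 ?addr0.
    by rewrite indicE mem_set // mul1r.
  move=> j ji; rewrite indicE memNset ?mul0r // => tj.
  by move: ji; rewrite (grid_cell_uniq ti tj) eqxx.
rewrite grid_quotient_out; last by move=> i ti; apply: h; exists i.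
rewrite /trform !mul0mx mxtrace0 big1 // => i _.
by rewrite indicE memNset ?mul0r // => ti; apply: h; exists i.
Qed.

Lemma measurable_grid_cell N i : measurable (grid_cell N i).
Proof. exact: measurable_itv. Qed.

Lemma measurable_grid_quotient (D : set R) Phi N k l :
  measurable_fun D (fun t => grid_quotient Phi N t k l).
Proof.
rewrite [X in measurable_fun _ X](_ : _ = fun t => \sum_(i < N.+1)
    \1_(grid_cell N i) t * grid_slope Phi N i k l); last first.
  by apply/funext => t; rewrite summxE; apply: eq_bigr => i _; rewrite mxE.
apply: measurable_sum => i; apply: measurable_funM; last exact: measurable_cst.
by apply: measurable_indic; exact: measurable_grid_cell.
Qed.

(** The integral of this step function is exactly the finite-difference sum of [Phi] over the
    grid. *)
Lemma grid_quotient_energy S Phi C N : energy_le S Phi C ->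
  (\int[lam]_(t in `[0%R, 1%R])
    (trform S (grid_quotient Phi N t) (grid_quotient Phi N t))%:E <= C%:E)%E.
Proof.
move=> /(_ _ _ _ (grid_family N)) PC.
have m01 : measurable (`[0, 1]%classic : set (measurableTypeR R)) by exact: measurable_itv.
have sub i : (i < N.+1)%N -> grid_cell N i `<=` `[0, 1]%classic.
  move=> iN t; have [/(_ (Ordinal iN)) /= [h0 [_ h1]] _] := grid_family N.
  rewrite /grid_cell /= !in_itv /= => /andP[h2 /ltW h3].
  by rewrite (le_trans h0 h2) (le_trans h3 h1).
have lam_cell i : lam (grid_cell N i) = (N.+1%:R^-1)%:E.
  rewrite /grid_cell /lam lebesgue_measure_itv /= lte_fin -EFinB gridS.
  by rewrite -subr_gt0 gridS invr_gt0 ltr0Sn.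
have lamE (i : 'I_N.+1) :
    (\int[lam]_(t in `[0%R, 1%R]) (\1_(grid_cell N i) t : R)%:E)%E = (N.+1%:R^-1)%:E.
  rewrite integral_indic //; last exact: measurable_grid_cell.
  by rewrite setIidl; [exact: lam_cell|exact: sub].
have iI (i : 'I_N.+1) : lam.-integrable `[0, 1]%classic (EFin \o \1_(grid_cell N i)).
  apply/integrableP; split.
    apply/measurable_EFinP; apply: measurable_indic; exact: measurable_grid_cell.
  under eq_integral do rewrite /= ger0_norm ?ler0n //.
  by rewrite lamE ltry.
have [_ H] := @integral_lincomb R `[0, 1]%classic 'I_N.+1 (index_enum 'I_N.+1)
  (fun i => \1_(grid_cell N i)) (fun=> N.+1%:R^-1)
  (fun i => trform S (grid_slope Phi N i) (grid_slope Phi N i)) m01 iI lamE.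
under eq_integral do rewrite trform_grid_quotient.
rewrite [leLHS]H lee_fin; apply: le_trans PC.
rewrite le_eqVlt; apply/orP; left; apply/eqP; apply: eq_bigr => i _.
(* Two factors [N.+1%:R] from the slopes against one cell length leave the inverse length of
   [energy_le]. *)
rewrite gridS /grid_slope trformZl trformZr; field.
by rewrite addrC natr1 pnatr_eq0.
Qed.

(** The cell containing [t] straddles it and shrinks as [N] grows. *)
Lemma grid_quotient_cvg Phi t k l : 0 < t -> t < 1 ->
  derivable (fun s => Phi s k l) t 1 ->
  grid_quotient Phi N t k l @[N --> \oo] --> derive1 (fun s => Phi s k l) t.
Proof.
move=> t0 t1 df; apply/cvgrPdist_lt => e e0.
have [d d0 dP] := derivable_straddle df e0.
near=> N; rewrite distrC.
have [i ti] := grid_cellP N (ltW t0) t1.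
rewrite (grid_quotient_cell _ ti) !mxE.
have N0 : N.+1%:R = (grid N i.+1 - grid N i)^-1 by rewrite gridS invrK.
rewrite N0; move: ti; rewrite /grid_cell /= in_itv /= => /andP[h1 h2].
apply: dP => //; [exact: ltW|exact: le_lt_trans h1 h2|].
rewrite gridS -[d]invrK ltf_pV2 ?posrE ?invr_gt0 //.
apply: (@lt_trans _ _ N%:R); last by rewrite ltr_nat.
by near: N; exact: nbhs_infty_gtr.
Unshelve. all: by end_near. Qed.

End GridQuotients.

(** * Recovery of the derivative by Fatou's lemma *)

Section GridLimit.
Variables (R : realType) (n : nat).
Implicit Types (S : 'M[R]_n) (Phi : R -> 'M[R]_n).
Let lam := @lebesgue_measure R.

(** The filter is arbitrary because sequences, [within] neighbourhoods and an ultrafilter all occur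
    later. *)
Lemma cvg_sumr (T : Type) (F : set_system T) (FF : Filter F) (I : Type) (s : seq I)
    (f : I -> T -> R) (l : I -> R) :
  (forall i, f i x @[x --> F] --> l i) ->
  (\sum_(i <- s) f i x) @[x --> F] --> (\sum_(i <- s) l i : R).
Proof.
move=> fl; elim: s => [|i s ih].
  by rewrite big_nil; under eq_fun do rewrite big_nil; exact: cvg_cst.
by rewrite big_cons; under eq_fun do rewrite big_cons; exact: cvgD.
Qed.

Lemma cvg_prodr (T : Type) (F : set_system T) (FF : Filter F) (I : Type) (s : seq I)
    (f : I -> T -> R) (l : I -> R) :
  (forall i, f i x @[x --> F] --> l i) ->
  (\prod_(i <- s) f i x) @[x --> F] --> (\prod_(i <- s) l i : R).
Proof.
move=> fl; elim: s => [|i s ih].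
  by rewrite big_nil; under eq_fun do rewrite big_nil; exact: cvg_cst.
by rewrite big_cons; under eq_fun do rewrite big_cons; exact: cvgM.
Qed.

Lemma cvg_mulmx (T : Type) (F : set_system T) (FF : Filter F) (p q r : nat)
    (A : T -> 'M[R]_(p, q)) (B : T -> 'M[R]_(q, r))
    (A0 : 'M[R]_(p, q)) (B0 : 'M[R]_(q, r)) :
  (forall i j, A x i j @[x --> F] --> A0 i j) ->
  (forall i j, B x i j @[x --> F] --> B0 i j) ->
  forall i j, (A x *m B x) i j @[x --> F] --> (A0 *m B0) i j.
Proof.
move=> hA hB i j; rewrite mxE; under eq_fun do rewrite mxE.
by apply: cvg_sumr => k; exact: cvgM.
Qed.

Lemma cvg_trform S (T : Type) (F : set_system T) (FF : Filter F) (A B : T -> 'M[R]_n)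
    (A0 B0 : 'M[R]_n) :
  (forall i j, A x i j @[x --> F] --> A0 i j) ->
  (forall i j, B x i j @[x --> F] --> B0 i j) ->
  trform S (A x) (B x) @[x --> F] --> trform S A0 B0.
Proof.
move=> hA hB; apply: cvg_sumr => i; apply: cvg_mulmx => k l.
  by apply: cvg_mulmx => // ? ?; exact: cvg_cst.
by rewrite mxE; under eq_fun do rewrite mxE; exact: hB.
Qed.

(** An upper limit exists at every [t], which gives a measurable function everywhere; it is the
    derivative wherever [Phi] has one inside []0, 1[]. *)
Definition grid_limit Phi (t : R) : 'M[R]_n :=
  \matrix_(k, l) fine (limn_esup (fun N => (grid_quotient Phi N t k l)%:E)).

Lemma measurable_grid_limit (D : set R) Phi k l : measurable D ->
  measurable_fun D (fun t => grid_limit Phi t k l).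
Proof.
move=> mD; under eq_fun do rewrite mxE.
apply: (measurableT_comp (fine_measurable _)) => //.
apply: (measurable_fun_limn_esup (f := fun N t => (grid_quotient Phi N t k l)%:E)) => N.
by apply/measurable_EFinP; exact: measurable_grid_quotient.
Qed.

Lemma grid_limitE Phi t k l : 0 < t -> t < 1 ->
  derivable (fun s => Phi s k l) t 1 ->
  grid_limit Phi t k l = derive1 (fun s => Phi s k l) t.
Proof.
move=> t0 t1 /(grid_quotient_cvg t0 t1) h; rewrite mxE.
have /cvg_limn_einf_sup[_ ->] //: (grid_quotient Phi N t k l)%:E @[N --> \oo] -->
  (derive1 (fun s => Phi s k l) t)%:E.
by apply/fine_cvgP; split => //; exact: nearW.
Qed.

Lemma limn_einf_le (u : (\bar R)^nat) c : (forall N, u N <= c)%E ->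
  (limn_einf u <= c)%E.
Proof.
move=> uc; rewrite limn_einf_lim; apply: lime_le; first exact: is_cvg_einfs.
apply: nearW => N; apply: le_trans (uc N); apply: ereal_inf_lbound.
by exists N => /=.
Qed.

(** Almost everywhere the integrands of the grid energies converge to that of [grid_limit], and
    Fatou's lemma carries their common bound to the limit. *)
Lemma grid_limit_energy S Phi C : symPD S -> energy_le S Phi C ->
  (\int[lam]_(t in `[0%R, 1%R])
    (trform S (grid_limit Phi t) (grid_limit Phi t))%:E <= C%:E)%E.
Proof.
move=> Spd PC.
have mo : measurable (`]0, 1[%classic : set (measurableTypeR R)) by exact: measurable_itv.
have mg k l : measurable_fun (`]0, 1[ : set R) (fun t => grid_limit Phi t k l).
  exact: measurable_grid_limit.
have mqg : measurable_fun (`]0, 1[ : set R)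
    (fun t => (trform S (grid_limit Phi t) (grid_limit Phi t))%:E).
  by apply/measurable_EFinP; exact: measurable_trform.
pose q N t := (trform S (grid_quotient Phi N t) (grid_quotient Phi N t))%:E.
have mq N : measurable_fun (`]0, 1[ : set R) (q N).
  apply/measurable_EFinP; apply: measurable_trform => k l;
  exact: measurable_grid_quotient.
have q0 N t : (0 <= q N t)%E by rewrite lee_fin trform_ge0.
have aed : {ae lam, forall t (p : 'I_n * 'I_n), 0 < t < 1 ->
    derivable (fun s => Phi s p.1 p.2) t 1}.
  apply: (@filter_forall _ _ _ (almost_everywhere (@lebesgue_measure R))
    (ae_filter_ringOfSetsType (@lebesgue_measure R))) => p.
  have [rho [_ _]] := abs_cont01_derivable (energy_le_abs_cont p.1 p.2 Spd PC).
  apply: filterS; first exact: (ae_filter_ringOfSetsType (@lebesgue_measure R)).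
  by move=> t h /h [].
have E : (\int[lam]_(t in `]0%R, 1%R[)
    (trform S (grid_limit Phi t) (grid_limit Phi t))%:E =
    \int[lam]_(t in `]0%R, 1%R[) limn_einf (q ^~ t))%E.
  apply: ae_eq_integral => //.
    (* The lower limit is rewritten as minus an upper limit to obtain its measurability. *)
    rewrite [X in measurable_fun _ X](_ : _ =
        fun t => (- limn_esup (fun N => - q N t))%E); last first.
      by apply/funext => t; rewrite -[RHS]limn_einfN; congr limn_einf;
        apply/funext => N; exact/esym/oppeK.
    apply: measurableT_comp => //.
    by apply: (measurable_fun_limn_esup (f := fun N t => (- q N t)%E)) => N;
      exact: measurableT_comp.
  apply: filterS aed; first exact: (ae_filter_ringOfSetsType (@lebesgue_measure R)).
  move=> t d; rewrite /= in_itv /= => t01; have /andP[t0 t1] := t01.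
  suff /cvg_limn_einf_sup[-> //] : q N t @[N --> \oo] -->
      (trform S (grid_limit Phi t) (grid_limit Phi t))%:E.
  apply/fine_cvgP; split; first exact: nearW.
  by apply: cvg_trform => k l; have dkl := d (k, l) t01; rewrite grid_limitE //;
    exact: grid_quotient_cvg.
rewrite integral_itv_bndoo // [leLHS]E.
apply: (le_trans (fatou _ _ _ _)) => //.
apply: limn_einf_le => N.
rewrite -[leLHS](@integral_itv_bndoo _ _ _ _ true false); last exact: mq.
exact: grid_quotient_energy.
Qed.

End GridLimit.

(** * From finite energy to admissibility *)

Section FiniteEnergyAdmissible.
Variable R : realType.
Let lam := @lebesgue_measure R.

Lemma cvg_det (T : Type) (F : set_system T) (FF : Filter F) n
    (A : T -> 'M[R]_n) (A0 : 'M[R]_n) :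
  (forall i j, A x i j @[x --> F] --> A0 i j) -> \det (A x) @[x --> F] --> \det A0.
Proof.
move=> hA; apply: cvg_sumr => s; apply: cvgM; first exact: cvg_cst.
by apply: cvg_prodr => i; exact: hA.
Qed.

Lemma cvg_adj (T : Type) (F : set_system T) (FF : Filter F) n
    (A : T -> 'M[R]_n) (A0 : 'M[R]_n) :
  (forall i j, A x i j @[x --> F] --> A0 i j) ->
  forall i j, (\adj (A x)) i j @[x --> F] --> (\adj A0) i j.
Proof.
move=> hA i j; rewrite mxE; under eq_fun do rewrite mxE.
rewrite /cofactor; apply: cvgM; first exact: cvg_cst.
by apply: cvg_det => k l; rewrite !mxE; under eq_fun do rewrite !mxE; exact: hA.
Qed.

Lemma continuous01_bounded (f : R -> R) : {within `[0, 1], continuous f} ->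
  exists B, forall t, 0 <= t <= 1 -> `|f t| <= B.
Proof.
move=> fc; have [c1 _ h1] := EVT_max ler01 fc; have [c2 _ h2] := EVT_min ler01 fc.
exists (`|f c1| + `|f c2|) => t t01; rewrite ler_norml.
have t01' : t \in `[0, 1] by rewrite in_itv.
apply/andP; split.
  apply: le_trans (h2 _ t01'); rewrite lerNl.
  by apply: (le_trans (ler_norm _)); rewrite normrN lerDr.
by apply: le_trans (h1 _ t01') (le_trans (ler_norm _) _); rewrite lerDl.
Qed.

(** Cramer's formula without the case distinction of [invmx]: the entries are rational functions of
    those of [A], so continuity follows from that of determinants. *)
Definition adj_inv n (A : 'M[R]_n) : 'M[R]_n := (\det A)^-1 *: \adj A.

Lemma adj_invM n (A : 'M[R]_n) : A \in unitmx -> adj_inv A *m A = 1%:M.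
Proof.
rewrite unitmxE unitfE => dA.
by rewrite /adj_inv -scalemxAl mul_adj_mx scale_scalar_mx mulVf.
Qed.

Lemma continuous_adj_inv n (Phi : R -> 'M[R]_n) :
  (forall i j, {within `[0, 1], continuous (fun t => Phi t i j)}) ->
  (forall t, 0 <= t <= 1 -> Phi t \in unitmx) ->
  forall i j, {within `[0, 1], continuous (fun t => adj_inv (Phi t) i j)}.
Proof.
move=> Pc Pu i j.
rewrite (_ : (fun t => _) = fun t => (\det (Phi t))^-1 * \adj (Phi t) i j); last first.
  by apply/funext => t; rewrite mxE.
apply/subspace_continuousP => x x01.
have hA k l : Phi y k l @[y --> within `[0, 1]%classic (nbhs x)] --> Phi x k l.
  by have /subspace_continuousP := Pc k l; exact.
have dx : \det (Phi x) != 0.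
  by rewrite -unitfE -unitmxE Pu //; move: x01; rewrite /= in_itv.
apply: cvgM; last exact: cvg_adj.
by apply: cvgV => //; exact: cvg_det.
Qed.

(** By coercivity every entry of [g] is at most the square root of [c * trform S g g], and an entry
    of the product is a sum of [n] terms. This will make [K] square integrable. *)
Lemma mulmx_entry_sq_le n (S : 'M[R]_n) (B : R) : symPD S -> exists2 M : R, 0 <= M &
  forall (g P : 'M[R]_n), (forall i j, `|P i j| <= B) ->
  forall i j, (g *m P) i j ^+ 2 <= M * trform S g g.
Proof.
move=> Spd; have [c c0 cP] := trform_coercive Spd.
exists ((n%:R * B) ^+ 2 * c) => [|g P PB i j]; first by rewrite mulr_ge0 ?sqr_ge0 // ltW.
have B0 : 0 <= B by apply: le_trans (PB i j).
have q0 : 0 <= c * trform S g g by rewrite mulr_ge0 ?trform_ge0 // ltW.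
rewrite -real_normK ?num_real // -mulrA -(sqr_sqrtr q0) -exprMn.
rewrite lerXn2r ?nnegrE ?mulr_ge0 ?sqrtr_ge0 //.
rewrite mxE (le_trans (ler_norm_sum _ _ _)) //.
apply: (@le_trans _ _ (\sum_(k < n) B * Num.sqrt (c * trform S g g))).
  apply: ler_sum => k _; rewrite normrM mulrC ler_pM //.
  by rewrite -sqrtr_sqr ler_wsqrtr.
by rewrite sumr_const card_ord -mulrA mulr_natl.
Qed.

(** The velocity is [grid_limit Phi] times the inverse of [Phi], so the differential equation holds
    at every interior point of differentiability, not merely almost everywhere. *)
Lemma energy_admissible n m (Sigma : R -> 'M[R]_n) (Y0 Y1 : 'M[R]_(n, m))
    (Phi : R -> 'M[R]_n) (C : R) :
  symPD (Sigma 0) ->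
  (forall t, 0 <= t <= 1 -> Phi t \in unitmx) -> Phi 0 = 1%:M ->
  (forall t, 0 <= t <= 1 -> Sigma t = Phi t *m Sigma 0 *m (Phi t)^T) ->
  Y1 = Phi 1 *m Y0 -> energy_le (Sigma 0) Phi (2 * C) ->
  exists K, admissible Sigma Y0 Y1 K Phi /\ (J_KE (Sigma 0%R) K Phi <= C%:E)%E.
Proof.
move=> Spd Pu P0 PS PY PC.
have Pac i j : abs_cont01 (fun t => Phi t i j) by exact: energy_le_abs_cont PC.
have Pc i j := abs_cont01_continuous (Pac i j).
have Ic := continuous_adj_inv Pc Pu.
pose K t := grid_limit Phi t *m adj_inv (Phi t).
have KP t : 0 <= t <= 1 -> K t *m Phi t = grid_limit Phi t.
  by move=> t01; rewrite /K -mulmxA adj_invM ?mulmx1 // Pu.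
have m01 : measurable (`[0, 1]%classic : set (measurableTypeR R)) by exact: measurable_itv.
pose q t := trform (Sigma 0) (grid_limit Phi t) (grid_limit Phi t).
have qC : (\int[lam]_(t in `[0%R, 1%R]) (q t)%:E <= (2 * C)%:E)%E.
  exact: grid_limit_energy.
have mg i j : measurable_fun (`[0, 1] : set R) (fun t => grid_limit Phi t i j).
  exact: measurable_grid_limit.
have mq : measurable_fun (`[0, 1] : set R) (EFin \o q).
  by apply/measurable_EFinP; exact: measurable_trform.
have JC : (J_KE (Sigma 0%R) K Phi <= C%:E)%E.
  rewrite J_KE_trform.
  rewrite (_ : (\int[_]_(t in _) _)%E = \int[lam]_(t in `[0%R, 1%R]) (q t)%:E)%E; last first.
    by apply: eq_integral => t; rewrite inE /= in_itv /= => /KP ->.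
  have h2 : (0 <= (2^-1 : R)%:E)%E by rewrite lee_fin invr_ge0.
  apply: (le_trans (lee_wpmul2l h2 qC)).
  by rewrite -EFinM mulrA mulVf ?mul1r.
exists K; split=> //.
(* By continuity on a compact interval the inverse of [Phi] is bounded, so the squared entries of
   [K] are dominated by a multiple of [q]. *)
have [B BP] : exists B, forall t i j, 0 <= t <= 1 -> `|adj_inv (Phi t) i j| <= B.
  have [b bP] := choice (fun p : 'I_n * 'I_n => continuous01_bounded (Ic p.1 p.2)).
  exists (\sum_p `|b p|) => t i j t01; apply: (le_trans (bP (i, j) t t01)).
  by rewrite (bigD1 (i, j)) //= (le_trans (ler_norm _)) // lerDl sumr_ge0.
split.
  move=> i j.
  have mK : measurable_fun (`[0, 1] : set R) (fun t => K t i j).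
    apply: measurable_mulmx => // k l.
    exact: (subspace_continuous_measurable_fun (measurable_itv _) (Ic k l)).
  split=> //.
  have [M M0 MP] := mulmx_entry_sq_le B Spd.
  apply: (@le_lt_trans _ _ (\int[lam]_(t in `[0%R, 1%R]) (M%:E * (q t)%:E))%E).
    apply: ge0_le_integral => //.
    - by move=> t _; rewrite lee_fin sqr_ge0.
    - by apply/measurable_EFinP; exact: measurable_funX.
    - by apply: measurable_funeM.
    - move=> t; rewrite /= in_itv /= => t01; rewrite -EFinM lee_fin.
      by apply: MP => k l; exact: BP.
  rewrite ge0_integralZl_EFin //; last by move=> t _; rewrite lee_fin trform_ge0.
  rewrite lte_mul_pinfty ?lee_fin //.
  exact: le_lt_trans qC (ltry _).
split=> //; split=> //; split=> //; split.
  move=> t t01 dP i j; have /andP[t0 t1] := t01.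
  by rewrite KP ?(ltW t0) ?(ltW t1) // grid_limitE.
split=> //; split=> //.
exact: le_lt_trans JC (ltry _).
Qed.

End FiniteEnergyAdmissible.

(** * Existence of a minimizer *)

Section Minimizer.
Variable R : realType.

Lemma fmap_ultra (T T' : Type) (f : T -> T') (U : set_system T) :
  UltraFilter U -> UltraFilter (fmap f U).
Proof.
move=> UU; split; first exact: fmap_proper_filter.
move=> G PG UG; apply/seteqP; split=> // A GA.
have [//|UnA] := in_ultra_setVsetC (f @^-1` A) UU.
have GnA : G (~` A) by exact: UG.
by have [x []] := filter_ex (filterI GA GnA).
Qed.

Lemma ultra_cvg_bounded (U : set_system nat) (u : nat -> R) (B : R) :
  UltraFilter U -> (forall k, `|u k| <= B) -> exists x : R, u k @[k --> U] --> x.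
Proof.
move=> UU uB.
have : compact (`[- B, B]%classic : set R) by exact: segment_compact.
rewrite compact_ultra => /(_ (fmap u U) (fmap_ultra _ UU)) [|x [_ ux]]; last by exists x.
by apply: (@filterE _ U) => k /=; rewrite in_itv /= -ler_norml.
Qed.

(** For a fixed family the sum involves finitely many values of the curve, so it converges with them
    and the inequality survives. *)
Lemma energy_le_cvg n (S : 'M[R]_n) (U : set_system nat) (PU : ProperFilter U)
    (Phi_ : nat -> R -> 'M[R]_n) (Phi : R -> 'M[R]_n) (C_ : nat -> R) (C : R) :
  (forall k, energy_le S (Phi_ k) (C_ k)) ->
  (forall t i j, 0 <= t <= 1 -> Phi_ k t i j @[k --> U] --> Phi t i j) ->
  C_ k @[k --> U] --> C -> energy_le S Phi C.
Proof.
move=> PC Pcvg CC I a b dab; have [ab _] := dab.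
have icc l : 0 <= a l <= 1 /\ 0 <= b l <= 1.
  by have [h0 [h1 h2]] := ab l; rewrite h0 h2 (le_trans h1 h2) (le_trans h0 h1).
have Dcvg l i j : (Phi_ k (b l) - Phi_ k (a l)) i j @[k --> U] -->
    (Phi (b l) - Phi (a l)) i j.
  have [ha hb] := icc l; rewrite !mxE; under eq_fun do rewrite !mxE.
  by apply: cvgB; exact: Pcvg.
apply: ler_cvg_to CC _.
  apply: cvg_sumr => l; apply: cvgM; first exact: cvg_cst.
  by apply: cvg_trform => i j; exact: Dcvg.
by apply: nearW => k; exact: PC.
Qed.

Lemma J_KE_ge0 n (S : 'M[R]_n) (K Phi : R -> 'M[R]_n) : symPD S ->
  (0 <= J_KE S K Phi)%E.
Proof.
move=> Spd; rewrite J_KE_trform mule_ge0 ?lee_fin ?invr_ge0 //.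
by apply: integral_ge0 => t _; rewrite lee_fin trform_ge0.
Qed.

(** Only the curves are passed to the limit; the velocities of the approximants are discarded and a
    new one is built from the limit curve. *)
Lemma admissible_limit n m (Sigma : R -> 'M[R]_n) (Y0 Y1 : 'M[R]_(n, m)) (c : R) :
  (forall t, 0 <= t <= 1 -> symPD (Sigma t)) ->
  (forall e, 0 < e -> exists K Phi, admissible Sigma Y0 Y1 K Phi /\
     (J_KE (Sigma 0%R) K Phi <= (c + e)%:E)%E) ->
  exists K Phi, admissible Sigma Y0 Y1 K Phi /\ (J_KE (Sigma 0%R) K Phi <= c%:E)%E.
Proof.
move=> Spd happrox; have Spd0 : symPD (Sigma 0) by apply: Spd; rewrite lexx ler01.
have [Phi_ PhiP] : {Phi_ : nat -> R -> 'M[R]_n & forall k, exists2 K,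
    admissible Sigma Y0 Y1 K (Phi_ k) &
    (J_KE (Sigma 0%R) K (Phi_ k) <= (c + k.+1%:R^-1)%:E)%E}.
  apply: (@choice _ _ (fun k Phi => exists2 K, admissible Sigma Y0 Y1 K Phi &
    (J_KE (Sigma 0%R) K Phi <= (c + k.+1%:R^-1)%:E)%E)) => k.
  have [|K [Phi [h1 h2]]] := happrox k.+1%:R^-1; first by rewrite invr_gt0.
  by exists Phi, K.
have PS k t : 0 <= t <= 1 -> Phi_ k t *m Sigma 0 *m (Phi_ k t)^T = Sigma t.
  by move=> t01; have [K [_ [_ [_ [_ [_ [h _]]]]]] _] := PhiP k; rewrite -h.
(* One ultrafilter gives limits at all [t] at once, where a diagonal extraction would reach only
   countably many. *)
have [U [UU ooU]] := @ultraFilterLemma nat \oo _.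
have [cc cc0 ccP] := trform_coercive Spd0.
(* The form at [Phi_ k t] is the trace of [Sigma t], whatever [k]; coercivity then bounds the
   entries. *)
have bnd t i j k : 0 <= t <= 1 -> `|Phi_ k t i j| <= Num.sqrt (cc * \tr (Sigma t)).
  move=> t01; rewrite -sqrtr_sqr ler_wsqrtr // -(PS k) //; exact: ccP.
have [X XP] : {X : R * 'I_n * 'I_n -> R & forall p, 0 <= p.1.1 <= 1 ->
    Phi_ k p.1.1 p.1.2 p.2 @[k --> U] --> X p}.
  apply: (@choice _ _ (fun p x => 0 <= p.1.1 <= 1 ->
    Phi_ k p.1.1 p.1.2 p.2 @[k --> U] --> x)) => -[[t i] j] /=.
  have [t01|t01] := boolP (0 <= t <= 1); last by exists 0.
  have [x xP] := ultra_cvg_bounded UU (fun k => bnd t i j k t01).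
  by exists x.
pose Phi t : 'M[R]_n := \matrix_(i, j) X (t, i, j).
have Pcvg t i j : 0 <= t <= 1 -> Phi_ k t i j @[k --> U] --> Phi t i j.
  by move=> t01; rewrite mxE; exact: (XP (t, i, j)).
(* The equality constraints pass to the limit as expressions in [Phi_ k] whose value is the same for
   all [k]. *)
have cst p q (A_ : nat -> 'M[R]_(p, q)) (A B : 'M[R]_(p, q)) :
    (forall i j, A_ k i j @[k --> U] --> A i j) -> (forall k, A_ k = B) -> A = B.
  move=> h AB; apply/matrixP => i j; apply: (cvg_unique (@Rhausdorff R) (h i j)).
  rewrite (_ : (fun k => A_ k i j) = fun=> B i j); first exact: cvg_cst.
  by apply/funext => k; rewrite AB.
have r0 : 0 <= (0 : R) <= 1 by rewrite lexx ler01.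
have r1 : 0 <= (1 : R) <= 1 by rewrite lexx ler01.
have PhiS t : 0 <= t <= 1 -> Sigma t = Phi t *m Sigma 0 *m (Phi t)^T.
  move=> t01; apply/esym/(cst _ _ (fun k => Phi_ k t *m Sigma 0 *m (Phi_ k t)^T)).
    apply: cvg_mulmx => i j.
      by apply: cvg_mulmx => k l; [exact: Pcvg|exact: cvg_cst].
    by rewrite mxE; under eq_fun do rewrite mxE; exact: Pcvg.
  by move=> k; exact: PS.
have [K [Kadm KC]] : exists K, admissible Sigma Y0 Y1 K Phi /\
    (J_KE (Sigma 0%R) K Phi <= c%:E)%E.
  apply: energy_admissible => //.
  (* Invertibility is not a closed condition; it is read off from the factorization of the
     invertible matrix [Sigma t]. *)
  - move=> t t01; have := symPD_unitmx (Spd t t01); rewrite PhiS //.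
    by rewrite !unitmx_mul => /andP[/andP[]].
  - apply: (cst _ _ (Phi_ ^~ 0)) => [i j|k]; first exact: Pcvg.
    by have [K' [_ [_ [_ [h _]]]] _] := PhiP k.
  - apply/esym/(cst _ _ (fun k => Phi_ k 1 *m Y0)) => [|k].
      by apply: cvg_mulmx => k l; [exact: Pcvg|exact: cvg_cst].
    by have [K' [_ [_ [_ [_ [_ [_ [h _]]]]]]] _] := PhiP k.
  - apply: (@energy_le_cvg _ _ U _ Phi_ _ (fun k => 2 * (c + k.+1%:R^-1))) => //.
      by move=> k; have [K' h1 h2] := PhiP k; exact: admissible_energy h1 h2.
    apply: cvgM; first exact: cvg_cst.
    rewrite -[X in _ --> X]addr0; apply: cvgD; first exact: cvg_cst.
    (* The ultrafilter refines [\oo], so the harmonic error tends to 0 along it. *)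
    apply: cvg_trans (@cvg_harmonic R) => A; exact: ooU.
by exists K, Phi.
Qed.

End Minimizer.

Theorem theorem1 (R : realType) (n m : nat) (Sigma : R -> 'M[R]_n)
  (Y0 Y1 : 'M[R]_(n, m)) :
  (2 <= n)%N -> (1 <= m)%N -> (m < n)%N ->
  C1_curve01 Sigma ->
  (forall t, 0 <= t <= 1 -> symPD (Sigma t)) ->
  (exists K Phi, admissible Sigma Y0 Y1 K Phi) ->
  exists Ks Phis, admissible Sigma Y0 Y1 Ks Phis /\
    forall K Phi, admissible Sigma Y0 Y1 K Phi ->
      (J_KE (Sigma 0%R) Ks Phis <= J_KE (Sigma 0%R) K Phi)%E.
Proof.
move=> _ _ _ _ Spd [K0 [Phi0 adm0]].
have Spd0 : symPD (Sigma 0) by apply: Spd; rewrite lexx ler01.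
(* Admissible costs are finite and nonnegative, so the infimum can be taken among real numbers. *)
pose V := [set x : R | exists K Phi, admissible Sigma Y0 Y1 K Phi /\
  J_KE (Sigma 0%R) K Phi = x%:E].
have Jfin K Phi : admissible Sigma Y0 Y1 K Phi ->
    J_KE (Sigma 0%R) K Phi = (fine (J_KE (Sigma 0%R) K Phi))%:E.
  move=> [_ [_ [_ [_ [_ [_ [_ Jlt]]]]]]]; rewrite fineK //.
  by rewrite ge0_fin_numE // J_KE_ge0.
have Vinf : has_inf V.
  split; first by exists (fine (J_KE (Sigma 0%R) K0 Phi0)), K0, Phi0; rewrite -Jfin.
  by exists 0 => x [K [Phi [_ Jx]]]; rewrite -lee_fin -Jx J_KE_ge0.
have [|Ks [Phis [adms Js]]] := @admissible_limit R n m Sigma Y0 Y1 (inf V) Spd.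
  move=> e e0; have [x [K [Phi [adm Jx]]] xe] := inf_adherent e0 Vinf.
  by exists K, Phi; rewrite Jx lee_fin ltW.
exists Ks, Phis; split=> // K Phi adm; apply: (le_trans Js).
rewrite Jfin // lee_fin; apply: ge_inf; first exact: Vinf.2.
by exists K, Phi; rewrite -Jfin.
Qed.
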